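(* Let $\omega\in\Omega$ be given, $\omega=xy-(\phi(x)+y\psi(x))$ with $\phi,\psi\in\mathbf{k}[x]$. The following statements are equivalent: (a) For every Rota-Baxter operator $P$ (of weight $\lambda$) on every algebra $R$, the unique coextension $\widehat{P}^{\,\omega}$ of $P$ to $R^{\mathbb N}$ satisfying $\partial_R\widehat{P}^{\,\omega}=\phi(\partial_R)+\widehat{P}^{\,\omega}\psi(\partial_R)$ is a Rota-Baxter operator (of weight $\lambda$). (b) For every differential operator $d$ (of weight $\lambda$) on every algebra $R$, the canonical extension $\hat d^{\,\omega}$ of $d$ to $\mathrm{Sh}(R)$ is a differential operator (of weight $\lambda$). (c) The functor $G_\omega:\mathbf{OA}\to\mathbf{ODA}_\omega$ restricts to a functor $G_\omega:\mathbf{RBA}\to\mathbf{DRB}_\omega$. (d) The functor $F_\omega:\mathbf{OA}_0\to\mathbf{ORB}_\omega$ restricts to a functor $F_\omega:\mathbf{DIF}\to\mathbf{DRB}_\omega$. (e) There is a lifting $\tilde{\mathbf C}=\langle\tilde C,\tilde\varepsilon,\tilde\delta\rangle$ of the comonad $\mathbf C$ on $\mathbf{RBA}$, where $\tilde C(R,P)=(R^{\mathbb N},\widetilde P)$, and an isomorphism $\widetilde H:\mathbf{DRB}_\omega\to\mathbf{RBA}_{\tilde{\mathbf C}}$ over $\mathbf{RBA}$ given by $\widetilde H(R,d,P)=\langle (R,P),\ \theta_{(R,d,P)}:(R,P)\to(R^{\mathbb N},\widetilde P)\rangle$, where $\theta_{(R,d,P)}(u)_n:=d^n(u)$ for all $u\in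 R$, $n\in\mathbb N$. (f) There is a lifting $\tilde{\mathbf T}=\langle\tilde T,\tilde\eta,\tilde\mu\rangle$ of the monad $\mathbf T$ on $\mathbf{DIF}$, where $\tilde T(R,d)=(\mathrm{Sh}(R),\tilde d)$, and an isomorphism $\widetilde K:\mathbf{DRB}_\omega\to\mathbf{DIF}^{\tilde{\mathbf T}}$ over $\mathbf{DIF}$ given by $\widetilde K(R,d,P)=\langle (R,d),\ \vartheta_{(R,d,P)}:(\mathrm{Sh}(R),\tilde d)\to(R,d)\rangle$, where $\vartheta_{(R,d,P)}(v_0\otimes v_1\otimes\cdots\otimes v_m):=v_0P(v_1P(\cdots P(v_m)\cdots))$ for all $v_0\otimes v_1\otimes\cdots\otimes v_m\in\mathrm{Sh}(R)$. (g) There is a mixed distributive law $\beta:TC\to CT$ of $\mathbf T$ over $\mathbf C$ such that $(\mathbf{ALG}_{\mathbf C})^{\tilde{\mathbf T}_\beta}$ is isomorphic to the category $\mathbf{DRB}_\omega$, where $\tilde{\mathbf T}_\beta$ is the lifting monad of $\mathbf T$ on $\mathbf{ALG}_{\mathbf C}$ given by the mixed distributive law $\beta$.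
   Context: Conventions. $\mathbf k$ is a fixed commutative ring with identity and $\lambda\in\mathbf k$ is fixed. All algebras are commutative $\mathbf k$-algebras with identity; all operators are $\mathbf k$-linear; algebra homomorphisms preserve the identity; homomorphisms of algebras with operators are algebra homomorphisms commuting with the given operators. $\mathbb N=\{0,1,2,\dots\}$, $\mathbb N_+=\{1,2,\dots\}$. Products of operators are compositions; for a polynomial $\phi\in\mathbf k[x]$ and an operator $q$, $\phi(q)$ is the usual evaluation (constant terms multiply the identity operator). A differential operator of weight $\lambda$ on $R$ is an operator $d$ with $d(xy)=d(x)y+xd(y)+\lambda d(x)d(y)$ for all $x,y$ and $d(\mathbf 1_R)=0$; $(R,d)$ is then a differential algebra. A Rota-Baxter operator of weight $\lambda$ is an operator $P$ with $P(x)P(y)=P(P(x)y)+P(xP(y))+\lambda P(xy)$ for all $x,y$; $(R,P)$ is then a Rota-Baxter algebra. An operated algebra is an algebra with an operator. $\Omega=\{xy-(\phi(x)+y\psi(x))\mid \phi,\psi\in\mathbf k[x]\}\subset\mathbf k\langle x,y\rangle$ (noncommuting variables). For $\omega=xy-(\phi(x)+y\psi(x))$ and operators $q,Q$ on $R$, $\omega(q,Q)=0$ means $qQ=\phi(q)+Q\psi(q)$. Categories. $\mathbf{ALG}$: algebras. $\mathbf{OA}$: operated algebras. $\mathbf{OA}_0$: operated algebras $(R,q)$ with $q(\mathbf 1_R)=0$. $\mathbf{DIF}$, $\mathbf{RBA}$: differential, resp. Rota-Baxter, algebras of weight $\lambda$. $\mathbf{ODA}_\omega$: type $\omega$ operated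 differential algebras, i.e. triples $(R,d,Q)$ with $(R,d)\in\mathbf{DIF}$, $Q$ an operator, $\omega(d,Q)=0$. $\mathbf{ORB}_\omega$: type $\omega$ operated Rota-Baxter algebras, i.e. triples $(R,q,P)$ with $q$ an operator, $q(\mathbf 1_R)=0$, $(R,P)\in\mathbf{RBA}$, $\omega(q,P)=0$. $\mathbf{DRB}_\omega$: type $\omega$ differential Rota-Baxter algebras, i.e. triples $(R,d,P)$ with $(R,d)\in\mathbf{DIF}$, $(R,P)\in\mathbf{RBA}$, $\omega(d,P)=0$. Morphisms are homomorphisms commuting with all the operators. Hurwitz series. For an algebra $A$, $A^{\mathbb N}$ is the module of sequences $f=(f_n)_{n\in\mathbb N}$ in $A$ with product $(fg)_n=\sum_{k=0}^n\sum_{j=0}^{n-k}\binom nk\binom{n-k}{j}\lambda^k f_{n-j}g_{k+j}$; $\partial_A(f)_n=f_{n+1}$ is a differential operator of weight $\lambda$ on it. For a homomorphism $\varphi:A\to B$, $\varphi^{\mathbb N}(f)_n=\varphi(f_n)$. The comonad $\mathbf C=\langle C,\varepsilon,\delta\rangle$ on $\mathbf{ALG}$ is $C(A)=A^{\mathbb N}$, $C(\varphi)=\varphi^{\mathbb N}$, $\varepsilon_A(f)=f_0$, $\delta_A:A^{\mathbb N}\to(A^{\mathbb N})^{\mathbb N}$, $\delta_A(f)_n=\partial_A^n(f)$. The category $\mathbf{ALG}_{\mathbf C}$ of $\mathbf C$-coalgebras is isomorphic to $\mathbf{DIF}$ over $\mathbf{ALG}$ ($(R,d)$ corresponds to the coalgebra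 $u\mapsto(d^n(u))_n$). Free Rota-Baxter algebras. For an algebra $A$, $\mathrm{Sh}(A)=\bigoplus_{i\in\mathbb N_+}A^{\otimes i}$ with the mixable shuffle product $\diamond$: for $\mathfrak a=a_0\otimes\cdots\otimes a_m$, $\mathfrak b=b_0\otimes\cdots\otimes b_n$, if $m=0$ then $\mathfrak a\diamond\mathfrak b=(a_0b_0)\otimes b_1\otimes\cdots\otimes b_n$; if $n=0$ then $\mathfrak a\diamond\mathfrak b=(a_0b_0)\otimes a_1\otimes\cdots\otimes a_m$; and if $m,n>0$, inductively, $\mathfrak a\diamond\mathfrak b=(a_0b_0)\otimes\big((a_1\otimes\cdots\otimes a_m)\diamond(\mathbf 1_A\otimes b_1\otimes\cdots\otimes b_n)+(\mathbf 1_A\otimes a_1\otimes\cdots\otimes a_m)\diamond(b_1\otimes\cdots\otimes b_n)+\lambda(a_1\otimes\cdots\otimes a_m)\diamond(b_1\otimes\cdots\otimes b_n)\big)$. The operator $P_A(x_0\otimes\cdots\otimes x_n)=\mathbf 1_A\otimes x_0\otimes\cdots\otimes x_n$ is a Rota-Baxter operator of weight $\lambda$. The monad $\mathbf T=\langle T,\eta,\mu\rangle$ on $\mathbf{ALG}$ is $T(A)=\mathrm{Sh}(A)$, $T(\varphi)$ acting by $\varphi$ on each tensor factor, $\eta_A:A\to\mathrm{Sh}(A)$ the inclusion, $\mu_A:\mathrm{Sh}(\mathrm{Sh}(A))\to\mathrm{Sh}(A)$, $\mu_A(u_0\otimes\cdots\otimes u_n)=u_0P_A(u_1P_A(\cdots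 P_A(u_n)\cdots))$. The category $\mathbf{ALG}^{\mathbf T}$ of $\mathbf T$-algebras is isomorphic to $\mathbf{RBA}$ over $\mathbf{ALG}$. Canonical (co)extensions. A coextension of an operator $Q$ on $R$ to $R^{\mathbb N}$ is an operator $\widehat Q$ on $R^{\mathbb N}$ with $\widehat Q(f)_0=Q(f_0)$ for all $f$. For $\omega=xy-(\phi(x)+y\psi(x))\in\Omega$ with $\phi,\psi\in\mathbf k[x]$, there is a unique coextension $\widehat Q^{\,\omega}$ with $\partial_R\widehat Q^{\,\omega}=\phi(\partial_R)+\widehat Q^{\,\omega}\psi(\partial_R)$. For an operator $q$ on $R$ with $q(\mathbf 1_R)=0$, there is a unique operator $\hat q^{\,\omega}$ on $\mathrm{Sh}(R)$ with $\hat q^{\,\omega}|_R=q$, $\hat q^{\,\omega}(\bigoplus_{i=1}^nR^{\otimes i})\subseteq\bigoplus_{i=1}^nR^{\otimes i}$ for each $n\in\mathbb N_+$, and, for $u=u_0\otimes u'\in R^{\otimes(n+1)}$ with $u_0\in R$, $u'\in R^{\otimes n}$, $n\in\mathbb N_+$, $\hat q^{\,\omega}(u)=q(u_0)\otimes u'+(u_0+\lambda q(u_0))\diamond(\phi(\hat q^{\,\omega})+P_R\psi(\hat q^{\,\omega}))(u')$. The functor $G_\omega:\mathbf{OA}\to\mathbf{ODA}_\omega$ is $(R,Q)\mapsto(R^{\mathbb N},\partial_R,\widehat Q^{\,\omega})$, $\varphi\mapsto\varphi^{\mathbb N}$; the functor $F_\omega:\mathbf{OA}_0\to\mathbf{ORB}_\omega$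 is $(R,q)\mapsto(\mathrm{Sh}(R),\hat q^{\,\omega},P_R)$, $\varphi\mapsto T(\varphi)$. Liftings and mixed distributive laws. With $U:\mathbf{RBA}\to\mathbf{ALG}$ the forgetful functor, a comonad $\tilde{\mathbf C}=\langle\tilde C,\tilde\varepsilon,\tilde\delta\rangle$ on $\mathbf{RBA}$ lifts $\mathbf C$ if $U\tilde C=CU$, $U\tilde\varepsilon=\varepsilon U$, $U\tilde\delta=\delta U$; $\mathbf{RBA}_{\tilde{\mathbf C}}$ is its category of coalgebras. With $V:\mathbf{DIF}\to\mathbf{ALG}$ the forgetful functor, a monad $\tilde{\mathbf T}=\langle\tilde T,\tilde\eta,\tilde\mu\rangle$ on $\mathbf{DIF}$ lifts $\mathbf T$ if $V\tilde T=TV$, $V\tilde\eta=\eta V$, $V\tilde\mu=\mu V$; $\mathbf{DIF}^{\tilde{\mathbf T}}$ is its category of algebras. (In (e), $\widetilde P$ denotes the Rota-Baxter operator on $R^{\mathbb N}$ that is part of $\tilde C(R,P)$; in (f), $\tilde d$ denotes the differential operator on $\mathrm{Sh}(R)$ that is part of $\tilde T(R,d)$.) An isomorphism of categories ''over'' $\mathbf{RBA}$ (resp. $\mathbf{DIF}$) is one commuting with the forgetful functors to $\mathbf{RBA}$ (resp. $\mathbf{DIF}$). A mixed distributive law of $\mathbf T$ over $\mathbf C$ is a natural transformation $\beta:TC\to CT$ with $\beta\circ\eta C=C\eta$, $\varepsilon T\circ\beta=T\varepsilon$, $\delta T\circ\beta=C\beta\circ\beta C\circ T\delta$, $\beta\circ\mu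 C=C\mu\circ\beta T\circ T\beta$. It yields the lifting monad $\tilde{\mathbf T}_\beta$ of $\mathbf T$ on $\mathbf{ALG}_{\mathbf C}$ with $\tilde T_\beta\langle A,f\rangle=\langle T(A),\beta_A\circ T(f)\rangle$ and with unit and multiplication given by those of $\mathbf T$; $(\mathbf{ALG}_{\mathbf C})^{\tilde{\mathbf T}_\beta}$ is its category of algebras.
   Formalization: In (g), ''isomorphic'' is taken as the canonical isomorphism, sending (R,d,P) to the coalgebra u↦(dⁿ(u))ₙ with structure map v₀P(v₁P(⋯P(v_m)⋯)); with a merely abstract isomorphism of categories, (g) does not imply (a). *)

(* Defs.v *)
From HB Require Import structures.
From mathcomp Require Import all_boot all_algebra boolp.
From mathcomp Require Import ring zify.

Set Implicit Arguments.
Unset Strict Implicit.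
Unset Printing Implicit Defensive.

Import GRing.Theory.
Local Open Scope ring_scope.
Local Open Scope quotient_scope.

(* The ground ring and the algebras may be zero, which rules out MathComp's
   comAlgType (its members are nonzero rings); hence a k-module with a
   commutative, associative, unital, k-bilinear multiplication. *)
Record calgType (k : comPzRingType) := CAlg {
  calg_mod : lmodType k;
  calg_one : calg_mod;
  calg_mul : calg_mod -> calg_mod -> calg_mod;
  calg_mulA : associative calg_mul;
  calg_mulC : commutative calg_mul;
  calg_mul1 : left_id calg_one calg_mul;
  calg_mulDl : left_distributive calg_mul +%R;
  calg_scaleAl : forall (c : k) x y,
    c *: calg_mul x y = calg_mul (c *: x) y
}.

Definition calg_sort (k : comPzRingType) (A : calgType k) : Type := calg_mod A.
Coercion calg_sort : calgType >-> Sortclass.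

HB.instance Definition _ (k : comPzRingType) (A : calgType k) :=
  GRing.Lmodule.copy (calg_sort A) (calg_mod A).
HB.instance Definition _ (k : comPzRingType) (A : calgType k) :=
  GRing.Zmodule_isComPzRing.Build (calg_sort A)
    (@calg_mulA k A) (@calg_mulC k A) (@calg_mul1 k A) (@calg_mulDl k A).

Lemma calg_scalerAl (k : comPzRingType) (A : calgType k) (c : k) (x y : A) :
  c *: (x * y) = (c *: x) * y.
Proof. exact: calg_scaleAl. Qed.

Lemma calg_scalerAr (k : comPzRingType) (A : calgType k) (c : k) (x y : A) :
  c *: (x * y) = x * (c *: y).
Proof. by rewrite mulrC calg_scalerAl mulrC. Qed.

Record alg_hom (k : comPzRingType) (A B : calgType k) := AlgHom {
  alg_fun :> A -> B;
  alg_linear : linear alg_fun;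
  alg_hom1 : alg_fun 1 = 1;
  alg_homM : forall x y, alg_fun (x * y) = alg_fun x * alg_fun y
}.

HB.instance Definition _ (k : comPzRingType) (A B : calgType k)
  (f : alg_hom A B) := GRing.isLinear.Build k A B _ (alg_fun f) (@alg_linear k A B f).

Lemma alg_hom_ext (k : comPzRingType) (A B : calgType k) (f g : alg_hom A B) :
  f =1 g -> f = g.
Proof.
case: f g => [f ? ? ?] [g ? ? ?] /= /funext fg; subst g.
by congr AlgHom; apply: Prop_irrelevance.
Qed.

Lemma linear_ext (k : comPzRingType) (A B : lmodType k)
  (f g : {linear A -> B}) : f =1 g -> f = g.
Proof.
case: f g => [f [[f0] [f1]]] [g [[g0] [g1]]] /= /funext fg; subst g.
by rewrite (Prop_irrelevance f0 g0) (Prop_irrelevance f1 g1).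
Qed.

Definition is_diff (k : comPzRingType) (lam : k) (R : calgType k)
    (d : {linear R -> R}) : Prop :=
  (forall x y, d (x * y) = d x * y + x * d y + lam *: (d x * d y)) /\ d 1 = 0.

Definition is_rb (k : comPzRingType) (lam : k) (R : calgType k)
    (P : {linear R -> R}) : Prop :=
  forall x y, P x * P y = P (P x * y) + P (x * P y) + lam *: P (x * y).

(* Evaluation of a polynomial at an operator. A polynomial over k is given by
   its list of coefficients, p = \sum_i p`_i x^i, because {poly k} requires k
   to be nonzero. *)
Definition peval (k : comPzRingType) (M : lmodType k) (p : seq k) (q : M -> M)
    (u : M) : M :=
  \sum_(i < size p) p`_i *: iter i q u.

Section PevalTheory.
Variables (k : comPzRingType) (M : lmodType k) (p : seq k) (q : M -> M).
Hypothesis lq : linear q.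

Lemma iter_lin n : linear (iter n q).
Proof. by elim: n => [|n IH] a u v //=; rewrite IH lq. Qed.

Lemma peval_lin : linear (peval p q).
Proof.
move=> a u v; rewrite /peval scaler_sumr -big_split /=; apply: eq_bigr => i _.
by rewrite iter_lin scalerDr !scalerA mulrC.
Qed.

End PevalTheory.

Definition iter_is_linear (k : comPzRingType) (M : lmodType k)
  (q : {linear M -> M}) n := iter_lin (linearP q) n.

Definition peval_is_linear (k : comPzRingType) (M : lmodType k) (p : seq k)
  (q : {linear M -> M}) := peval_lin p (linearP q).

Definition seqmod (k : comPzRingType) (M : lmodType k) : Type := nat -> M.

Section SeqMod.
Variables (k : comPzRingType) (M : lmodType k).
Notation S := (seqmod M).

Let saddA : associative (fun (f g : S) n => f n + g n).
Proof. by move=> f g h; apply: funext => n; rewrite addrA. Qed.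
Let saddC : commutative (fun (f g : S) n => f n + g n).
Proof. by move=> f g; apply: funext => n; rewrite addrC. Qed.
Let sadd0 : left_id (fun=> 0) (fun (f g : S) n => f n + g n).
Proof. by move=> f; apply: funext => n; rewrite add0r. Qed.
Let saddN : left_inverse (fun=> 0) (fun f n => - f n) (fun (f g : S) n => f n + g n).
Proof. by move=> f; apply: funext => n; rewrite addNr. Qed.

HB.instance Definition _ := gen_eqMixin S.
HB.instance Definition _ := gen_choiceMixin S.
HB.instance Definition _ := GRing.isZmodule.Build S saddA saddC sadd0 saddN.

Let sscaleA (a b : k) (f : S) :
  (fun n => a *: (b *: f n)) = (fun n => (a * b) *: f n).
Proof. by apply: funext => n; rewrite scalerA. Qed.
Let sscale1 : left_id 1 (fun (a : k) (f : S) n => a *: f n).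
Proof. by move=> f; apply: funext => n; rewrite scale1r. Qed.
Let sscaleDr : right_distributive (fun (a : k) (f : S) n => a *: f n) +%R.
Proof. by move=> a f g; apply: funext => n; rewrite scalerDr. Qed.
Let sscaleDl (f : S) (a b : k) :
  (fun n => (a + b) *: f n) = ((fun n => a *: f n) : S) + (fun n => b *: f n).
Proof. by apply: funext => n; rewrite scalerDl. Qed.

HB.instance Definition _ :=
  GRing.Zmodule_isLmodule.Build k S sscaleA sscale1 sscaleDr sscaleDl.

Lemma seqmodD (f g : S) n : (f + g) n = f n + g n. Proof. by []. Qed.
Lemma seqmodZ a (f : S) n : (a *: f) n = a *: f n. Proof. by []. Qed.

End SeqMod.

Section Hurwitz.
Variables (k : comPzRingType) (lam : k) (A : calgType k).
Notation S := (seqmod (calg_sort A)).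

Definition hur_mul (f g : S) : S := fun n =>
  \sum_(i < n.+1) \sum_(j < (n - i).+1)
    (lam ^+ i *+ ('C(n, i) * 'C(n - i, j))) *: (f (n - j)%N * g (i + j)%N).

Definition hur_one : S := fun n => if n == 0%N then 1 else 0.

Definition shift (f : S) : S := fun n => f n.+1.

Let t n i j := ('C(n, i) * 'C(n - i, j))%N.

Let tS n i j : t n.+1 i j =
  (t n i j + (if j is j'.+1 then t n i j' else 0)
           + (if i is i'.+1 then t n i' j else 0))%N.
Proof.
rewrite /t; case: i => [|i].
  by rewrite !bin0 !mul1n !subn0 addn0; case: j => [|j]; rewrite ?bin0 ?binS ?mul1n.
rewrite binS subSS mulnDl; congr (_ + _)%N.
case: (ltnP i n) => [lt_in|le_ni]; last by rewrite bin_small ?mul0n //; case: j.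
by rewrite -(subnSK lt_in) /=; case: j => [|j]; rewrite ?bin0 ?binS ?mulnDr ?addn0.
Qed.

Let t0 n i j : (n < i)%N || (n < j)%N -> t n i j = 0%N.
Proof.
case/orP => H; rewrite /t; first by rewrite bin_small.
by rewrite (bin_small (leq_ltn_trans (leq_subr _ _) H)) muln0.
Qed.

Let hurE N (f g : S) n : (n < N)%N ->
  hur_mul f g n = \sum_(i < N) \sum_(j < N)
    (lam ^+ i *+ t n i j) *: (f (n - j)%N * g (i + j)%N).
Proof.
move=> ltnN; rewrite /hur_mul.
rewrite -(big_mkord xpredT (fun i => \sum_(j < (n - i).+1)
   (lam ^+ i *+ t n i j) *: (f (n - j)%N * g (i + j)%N))).
rewrite -(big_mkord xpredT (fun i => \sum_(j < N)
   (lam ^+ i *+ t n i j) *: (f (n - j)%N * g (i + j)%N))).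
rewrite (@big_cat_nat _ _ _ n.+1 0 N) //= [X in _ = _ + X]big_nat_cond.
rewrite [X in _ = _ + X]big1 ?addr0; last first.
  move=> i /andP[/andP[ltni _] _]; apply: big1 => j _.
  by rewrite t0 ?ltni // mulr0n scale0r.
apply: eq_big_nat => i /andP[_ lein].
have lein' : ((n - i).+1 <= N)%N by apply: leq_ltn_trans (leq_subr _ _) ltnN.
rewrite (big_ord_widen N (fun j =>
   (lam ^+ i *+ t n i j) *: (f (n - j)%N * g (i + j)%N)) lein').
rewrite [RHS](bigID (fun j : 'I_N => (j < (n - i).+1)%N)) /=.
rewrite [X in _ = _ + X]big1 ?addr0 // => j.
by rewrite -leqNgt => lt; rewrite /t [X in (_ * X)%N]bin_small // muln0 mulr0n scale0r.
Qed.

Lemma hur_mul0 f g : hur_mul f g 0%N = f 0%N * g 0%N.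
Proof.
by rewrite /hur_mul big_ord1 subn0 big_ord1 subn0 addn0 !bin0 muln1 mulr1n expr0 scale1r.
Qed.

Lemma hur_mulS f g n : hur_mul f g n.+1 =
  hur_mul (shift f) g n + hur_mul f (shift g) n
  + lam *: hur_mul (shift f) (shift g) n.
Proof.
rewrite (@hurE n.+2 f g) // (@hurE n.+2 (shift f)) // (@hurE n.+1 f) // (@hurE n.+1 _ (shift g)) //.
transitivity (\sum_(i < n.+2) \sum_(j < n.+2)
    (lam ^+ i *+ t n i j) *: (f (n.+1 - j)%N * g (i + j)%N)
  + \sum_(i < n.+2) \sum_(j < n.+2)
    (lam ^+ i *+ (if j : nat is j'.+1 then t n i j' else 0%N)) *: (f (n.+1 - j)%N * g (i + j)%N)
  + \sum_(i < n.+2) \sum_(j < n.+2)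
    (lam ^+ i *+ (if i : nat is i'.+1 then t n i' j else 0%N)) *: (f (n.+1 - j)%N * g (i + j)%N)).
  rewrite -!big_split; apply: eq_bigr => i _; rewrite -!big_split; apply: eq_bigr => j _.
  by rewrite tS !mulrnDr !scalerDl.
congr (_ + _ + _).
- apply: eq_bigr => i _; apply: eq_bigr => j _; case: (ltnP n j) => nj.
    by rewrite t0 ?nj ?orbT // mulr0n !scale0r.
  by rewrite /shift subSn.
- rewrite [LHS]big_ord_recr /= [X in _ + X]big1 ?addr0; last first.
    by move=> [[|j] ltj] _ /=; rewrite ?t0 ?ltnSn // mulr0n scale0r.
  apply: eq_bigr => i _; rewrite big_ord_recl /= mulr0n scale0r add0r.
  by apply: eq_bigr => j _; rewrite /shift /bump /= add1n subSS addnS.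
- rewrite [LHS]big_ord_recl /= [X in X + _]big1 ?add0r; last first.
    by move=> j _; rewrite mulr0n scale0r.
  rewrite scaler_sumr; apply: eq_bigr => i _.
  rewrite [LHS]big_ord_recr /= /bump /= [X in _ + X](_ : _ = 0) ?addr0; last first.
    by rewrite t0 ?ltnSn ?orbT // mulr0n scale0r.
  rewrite scaler_sumr; apply: eq_bigr => j _.
  rewrite scalerA add1n exprS mulrnAr /shift addSn subSn //; exact: ltn_ord j.
Qed.

Lemma shift_mul f g : shift (hur_mul f g) =
  hur_mul (shift f) g + hur_mul f (shift g) + lam *: hur_mul (shift f) (shift g).
Proof. by apply: funext => n; rewrite /shift hur_mulS. Qed.

Lemma hur_mulC : commutative hur_mul.
Proof.
move=> f g; apply: funext => n; elim: n f g => [|n IH] f g.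
  by rewrite !hur_mul0 mulrC.
by rewrite !hur_mulS IH (IH f) (IH (shift f)) [X in X + _]addrC.
Qed.

Lemma hur_mulDl : left_distributive hur_mul +%R.
Proof.
move=> f g h; apply: funext => n; rewrite seqmodD.
elim: n f g h => [|n IH] f g h; first by rewrite !hur_mul0 mulrDl.
rewrite !hur_mulS (_ : shift (f + g) = shift f + shift g) // !IH scalerDr.
by rewrite [RHS]addrACA; congr (_ + _); rewrite addrACA.
Qed.

Lemma hur_scaleAl (c : k) (f g : S) :
  c *: hur_mul f g = hur_mul (c *: f) g.
Proof.
apply: funext => n; rewrite seqmodZ.
elim: n f g => [|n IH] f g; first by rewrite !hur_mul0 calg_scalerAl.
rewrite !hur_mulS (_ : shift (c *: f) = c *: shift f) // -!IH !scalerDr.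
by rewrite !scalerA [lam * c]mulrC.
Qed.

Lemma hur_mul0l g : hur_mul 0 g = 0.
Proof.
apply: funext => n; elim: n g => [|n IH] g; first by rewrite hur_mul0 mul0r.
by rewrite hur_mulS !IH scaler0 !addr0.
Qed.

Lemma hur_mul1 : left_id hur_one hur_mul.
Proof.
move=> f; apply: funext => n; elim: n f => [|n IH] f; first by rewrite hur_mul0 mul1r.
by rewrite hur_mulS (_ : shift hur_one = 0) // !hur_mul0l IH scaler0 add0r addr0.
Qed.

Lemma hur_mulA : associative hur_mul.
Proof.
have mulDr f g h : hur_mul f ((g : S) + h) = hur_mul f g + hur_mul f h.
  by rewrite hur_mulC hur_mulDl; congr (_ + _); exact: hur_mulC.
have scaleAr c f g : hur_mul f (c *: (g : S)) = c *: hur_mul f g.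
  by rewrite hur_mulC -hur_scaleAl; congr (_ *: _); exact: hur_mulC.
move=> f g h; apply: funext => n; elim: n f g h => [|n IH] f g h.
  by rewrite !hur_mul0 mulrA.
rewrite !hur_mulS !shift_mul !mulDr !hur_mulDl !scaleAr -!hur_scaleAl !seqmodD !seqmodZ !IH.
rewrite !scalerDr; ring.
Qed.

Definition hurwitz : calgType k :=
  CAlg hur_mulA hur_mulC hur_mul1 hur_mulDl hur_scaleAl.

Lemma shift_is_linear : linear (shift : hurwitz -> hurwitz).
Proof. by []. Qed.

Definition hur_der : {linear hurwitz -> hurwitz} :=
  HB.pack (shift : hurwitz -> hurwitz)
    (GRing.isLinear.Build k hurwitz hurwitz _ _ shift_is_linear).

Lemma hur_der_diff : is_diff lam hur_der.
Proof. by split => // x y; exact: shift_mul. Qed.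

End Hurwitz.

Section HurwitzMap.
Variables (k : comPzRingType) (lam : k).

Lemma hur_mulE (A : calgType k) (f g : hurwitz lam A) (n : nat) :
  (f * g : hurwitz lam A) n = hur_mul lam f g n.
Proof. by []. Qed.

Section Map.
Variables (A B : calgType k) (phi : alg_hom A B).
Let m (f : hurwitz lam A) : hurwitz lam B := fun n => phi (f n).
Let m_lin : linear m.
Proof. by move=> a u v; apply: funext => n; rewrite /m linearP. Qed.
Let m1 : m 1 = 1.
Proof. by apply: funext => -[|n]; [exact: alg_hom1 | exact: linear0]. Qed.
Let mM x y : m (x * y) = m x * m y.
Proof.
apply: funext => n; rewrite /m !hur_mulE /hur_mul raddf_sum; apply: eq_bigr => i _.
by rewrite raddf_sum; apply: eq_bigr => j _; rewrite /= linearZ /= alg_homM.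
Qed.
Definition hur_map : alg_hom (hurwitz lam A) (hurwitz lam B) := AlgHom m_lin m1 mM.
End Map.

Section Head.
Variable A : calgType k.
Definition hur_head : alg_hom (hurwitz lam A) A :=
  @AlgHom k (hurwitz lam A) A (fun f => f 0%N) (fun _ _ _ => erefl) erefl
    (fun f g => hur_mul0 lam f g).
End Head.

Section Theta.
Variables (A : calgType k) (d : {linear A -> A}) (dP : is_diff lam d).
Let th (u : A) : hurwitz lam A := fun n => iter n d u.
Let th_lin : linear th.
Proof. by move=> a u v; apply: funext => n; exact: iter_is_linear. Qed.
Let th1 : th 1 = 1.
Proof.
apply: funext => -[|n] //; rewrite /th iterSr dP.2.
by elim: n => //= n ->; exact: linear0.
Qed.
Let thM x y : th (x * y) = th x * th y.
Proof.
apply: funext => n; rewrite hur_mulE; elim: n x y => [|n IH] x y.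
  by rewrite hur_mul0.
have sh z : shift (th z) = th (d z) by apply: funext => i; rewrite /shift /th iterSr.
rewrite hur_mulS !sh -!IH /th iterSr dP.1 addrC iter_is_linear addrC.
by rewrite -[d x * y]scale1r iter_is_linear !scale1r.
Qed.
Definition theta : alg_hom A (hurwitz lam A) := AlgHom th_lin th1 thM.
End Theta.

End HurwitzMap.

(* The element xy - (phi(x) + y psi(x)) of k<x,y>. *)
Record omega (k : comPzRingType) := Omega { om_phi : seq k; om_psi : seq k }.

(* omega(q, Q) = 0, i.e. q Q = phi(q) + Q psi(q). *)
Definition of_type (k : comPzRingType) (w : omega k) (M : lmodType k)
    (q Q : M -> M) : Prop :=
  forall u, q (Q u) = peval (om_phi w) q u + Q (peval (om_psi w) q u).

Definition is_coext (k : comPzRingType) (lam : k) (R : calgType k)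
    (Q : R -> R) (Qh : hurwitz lam R -> hurwitz lam R) : Prop :=
  forall f, Qh f 0%N = Q (f 0%N).

Section Coextension.
Variables (k : comPzRingType) (lam : k) (w : omega k).
Variables (R : calgType k) (Q : {linear R -> R}).
Notation H := (hurwitz lam R).
Notation der := (hur_der lam R).

(* The defining equation, read at index n, is a recursion on n:
   Qh(f)_{n+1} = (der (Qh f))_n = (phi(der) f)_n + Qh(psi(der) f)_n.
   See coext_is_coext, coext_of_type and coext_unique. *)
Fixpoint coext_at (n : nat) (f : H) : R :=
  if n is n'.+1 then
    peval (om_phi w) der f n' + coext_at n' (peval (om_psi w) der f)
  else Q (f 0%N).

Lemma coext_atS n f : coext_at n.+1 f =
  peval (om_phi w) der f n + coext_at n (peval (om_psi w) der f).
Proof. by []. Qed.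

Lemma coext_is_linear : linear ((fun f n => coext_at n f) : H -> H).
Proof.
move=> a f g; apply: funext => n; rewrite [RHS]seqmodD seqmodZ.
elim: n f g => [|n IH] f g; first by rewrite /= -linearP.
by rewrite !coext_atS !(peval_is_linear _ der) IH [in LHS]seqmodD seqmodZ scalerDr addrACA.
Qed.

Definition canon_coext : {linear H -> H} :=
  HB.pack ((fun f n => coext_at n f) : H -> H)
    (GRing.isLinear.Build k H H _ _ coext_is_linear).

Lemma coext_is_coext : is_coext Q canon_coext.
Proof. by []. Qed.

Lemma coext_of_type : of_type w der canon_coext.
Proof. by []. Qed.

Lemma coext_unique (Qh : {linear H -> H}) :
  is_coext Q Qh -> of_type w der Qh -> Qh = canon_coext.
Proof.
move=> Q0 Qw; apply: linear_ext => f; apply: funext => n.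
elim: n f => [|n IH] f; first by rewrite Q0.
have -> : Qh f n.+1 = der (Qh f) n by [].
by rewrite Qw [LHS]seqmodD IH.
Qed.

End Coextension.

Section LinearComb.
Variables (k : comPzRingType) (U V W : lmodType k).

Lemma lin_comp (f : V -> W) (g : U -> V) :
  linear f -> linear g -> linear (fun x => f (g x)).
Proof. by move=> lf lg a x y; rewrite lg lf. Qed.

Lemma lin_add (f g : U -> V) :
  linear f -> linear g -> linear (fun x => f x + g x).
Proof. by move=> lf lg a x y; rewrite lf lg scalerDr addrACA. Qed.

Lemma lin_scale (c : k) (f : U -> V) : linear f -> linear (fun x => c *: f x).
Proof. by move=> lf a x y; rewrite lf scalerDr !scalerA mulrC. Qed.

Lemma lin_sum (I : Type) (r : seq I) (F : I -> U -> V) :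
  (forall i, linear (F i)) -> linear (fun x => \sum_(i <- r) F i x).
Proof.
move=> lF a x y; rewrite scaler_sumr -big_split; apply: eq_bigr => i _; exact: lF.
Qed.

End LinearComb.

Section TensorModule.
Variables (k : comPzRingType) (A : calgType k).

(* A pair (a, s) stands for the nonempty word a_0 = a, (a_1, ..., a_m) = s;
   g is a family of multilinear maps, one on A^i for every i >= 1. *)
Definition multilinear (N : lmodType k) (g : A -> seq A -> N) : Prop :=
  (forall s, linear (fun a => g a s)) /\
  (forall a s1 s2, linear (fun x => g a (s1 ++ x :: s2))).

Definition formal := seq (k * (A * seq A)).

Definition formal_eval (N : lmodType k) (g : A -> seq A -> N) (x : formal) : N :=
  \sum_(t <- x) t.1 *: g t.2.1 t.2.2.

(* shmod A is the direct sum of the tensor powers of A over all i >= 1: formal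
   k-linear combinations of nonempty words, modulo the kernel of all
   multilinear families. Its universal property is sh_fold_linear,
   sh_fold_tens and sh_lin_ext. *)
Definition formal_eq (x y : formal) : bool :=
  `[< forall (N : lmodType k) (g : A -> seq A -> N),
        multilinear g -> formal_eval g x = formal_eval g y >].

Lemma formal_eq_equiv : equiv_class_of formal_eq.
Proof.
split=> [x|x y|y x z]; rewrite /formal_eq.
- by apply/asboolP.
- by apply/asboolP/asboolP => H N g Hg; rewrite H.
- by move=> /asboolP H1 /asboolP H2; apply/asboolP => N g Hg; rewrite H1 ?H2.
Qed.
Canonical formal_eq_rel := EquivRelPack formal_eq_equiv.

Definition shmod : Type := {eq_quot formal_eq_rel}.
HB.instance Definition _ := Choice.on shmod.

Definition of_formal (x : formal) : shmod := \pi_{eq_quot formal_eq_rel} x.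
Definition to_formal (u : shmod) : formal :=
  repr (u : {eq_quot formal_eq_rel}).

Definition sh_fold (N : lmodType k) (g : A -> seq A -> N) (u : shmod) : N :=
  formal_eval g (to_formal u).

Lemma sh_fold_of (N : lmodType k) (g : A -> seq A -> N) x :
  multilinear g -> sh_fold g (of_formal x) = formal_eval g x.
Proof.
move=> Hg; rewrite /sh_fold.
have /eqmodP /asboolP : to_formal (of_formal x) = x %[mod {eq_quot formal_eq_rel}].
  exact: reprK.
by apply.
Qed.

Lemma sh_ext u v :
  (forall (N : lmodType k) (g : A -> seq A -> N), multilinear g ->
     sh_fold g u = sh_fold g v) -> u = v.
Proof.
move=> H; rewrite -[u](@reprK _ {eq_quot formal_eq_rel}).
rewrite -[v](@reprK _ {eq_quot formal_eq_rel}).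
by apply/eqmodP/asboolP => N g Hg; exact: H.
Qed.

Definition sh_zero : shmod := of_formal [::].
Definition sh_add (u v : shmod) : shmod := of_formal (to_formal u ++ to_formal v).
Definition sh_scale (c : k) (u : shmod) : shmod :=
  of_formal [seq (c * t.1, t.2) | t <- to_formal u].

Section Fold.
Variables (N : lmodType k) (g : A -> seq A -> N).
Hypothesis Hg : multilinear g.
Lemma sh_fold0 : sh_fold g sh_zero = 0.
Proof. by rewrite sh_fold_of // /formal_eval big_nil. Qed.
Lemma sh_foldD u v : sh_fold g (sh_add u v) = sh_fold g u + sh_fold g v.
Proof. by rewrite sh_fold_of // /formal_eval big_cat. Qed.
Lemma sh_foldZ c u : sh_fold g (sh_scale c u) = c *: sh_fold g u.
Proof.
rewrite sh_fold_of // /sh_fold /formal_eval big_map scaler_sumr.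
by apply: eq_bigr => t _; rewrite scalerA.
Qed.
End Fold.

Let shE := (sh_fold0, sh_foldD, sh_foldZ).

Let shaddA : associative sh_add.
Proof. by move=> u v w; apply: sh_ext => N g Hg; rewrite !shE // addrA. Qed.
Let shaddC : commutative sh_add.
Proof. by move=> u v; apply: sh_ext => N g Hg; rewrite !shE // addrC. Qed.
Let shadd0 : left_id sh_zero sh_add.
Proof. by move=> u; apply: sh_ext => N g Hg; rewrite !shE // add0r. Qed.
Let shaddN : left_inverse sh_zero (sh_scale (-1)) sh_add.
Proof. by move=> u; apply: sh_ext => N g Hg; rewrite !shE // scaleN1r addNr. Qed.
HB.instance Definition _ := GRing.isZmodule.Build shmod shaddA shaddC shadd0 shaddN.

Let shscaleA a b u : sh_scale a (sh_scale b u) = sh_scale (a * b) u.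
Proof. by apply: sh_ext => N g Hg; rewrite !shE // scalerA. Qed.
Let shscale1 : left_id 1 sh_scale.
Proof. by move=> u; apply: sh_ext => N g Hg; rewrite !shE // scale1r. Qed.
Let shscaleDr : right_distributive sh_scale +%R.
Proof. by move=> a u v; apply: sh_ext => N g Hg; rewrite !shE // scalerDr. Qed.
Let shscaleDl (u : shmod) a b : sh_scale (a + b) u = sh_scale a u + sh_scale b u.
Proof. by apply: sh_ext => N g Hg; rewrite !shE // scalerDl. Qed.
HB.instance Definition _ :=
  GRing.Zmodule_isLmodule.Build k shmod shscaleA shscale1 shscaleDr shscaleDl.

Lemma sh_fold_linear (N : lmodType k) (g : A -> seq A -> N) :
  multilinear g -> linear (sh_fold g).
Proof. by move=> Hg c u v; rewrite sh_foldD // sh_foldZ. Qed.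

(* The pure tensor a (x) s_1 (x) ... (x) s_m. *)
Definition tens (a : A) (s : seq A) : shmod := of_formal [:: (1, (a, s))].

Lemma sh_fold_tens (N : lmodType k) (g : A -> seq A -> N) a s :
  multilinear g -> sh_fold g (tens a s) = g a s.
Proof. by move=> Hg; rewrite sh_fold_of // /formal_eval big_seq1 scale1r. Qed.

Lemma tens_multilinear : multilinear tens.
Proof.
split=> [s|a s1 s2] c x y; apply: sh_ext => N g Hg;
  rewrite (sh_foldD Hg) (sh_foldZ Hg) !sh_fold_tens //; first exact: Hg.1.
exact: Hg.2.
Qed.

Lemma sh_sum u : u = \sum_(t <- to_formal u) t.1 *: tens t.2.1 t.2.2.
Proof.
apply: sh_ext => N g Hg; rewrite [LHS]/sh_fold /formal_eval.
elim: (to_formal u) => [|t r IH]; first by rewrite !big_nil sh_fold0.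
by rewrite !big_cons (sh_foldD Hg) (sh_foldZ Hg) sh_fold_tens // IH.
Qed.
 
Lemma lin0 (U V : lmodType k) (f : U -> V) : linear f -> f 0 = 0.
Proof. by move=> lf; have := lf (-1) 0 0; rewrite !scaleN1r oppr0 addr0 addNr. Qed.

Lemma sh_lin_ext (N : lmodType k) (f g : shmod -> N) :
  linear f -> linear g -> (forall a s, f (tens a s) = g (tens a s)) -> f =1 g.
Proof.
move=> lf lg fg u; rewrite (sh_sum u).
elim: (to_formal u) => [|t r IH]; first by rewrite big_nil (lin0 lf) (lin0 lg).
by rewrite big_cons lf lg IH fg.
Qed.

Lemma fold_lin (U N : lmodType k) (G : U -> A -> seq A -> N) u :
  (forall a s, linear (fun x => G x a s)) -> linear (fun x => sh_fold (G x) u).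
Proof. by move=> HG; apply: lin_sum => t; apply: lin_scale. Qed.

Lemma sh_fold_ext (N : lmodType k) (g h : A -> seq A -> N) u :
  (forall a s, g a s = h a s) -> sh_fold g u = sh_fold h u.
Proof. by move=> gh; apply: eq_bigr => t _; rewrite gh. Qed.

(* a (x) u. *)
Definition tcons (a : A) (u : shmod) : shmod :=
  sh_fold (fun b s => tens a (b :: s)) u.

Lemma tcons_ml a : multilinear (fun b s => tens a (b :: s)).
Proof.
split=> [s|b s1 s2]; first exact: (tens_multilinear.2 a [::] s).
exact: (tens_multilinear.2 a (b :: s1) s2).
Qed.

Lemma tcons_linr a : linear (tcons a).
Proof. exact: sh_fold_linear (tcons_ml a). Qed.

Lemma tconsD a u v : tcons a (u + v) = tcons a u + tcons a v.
Proof. by rewrite -[u]scale1r tcons_linr !scale1r. Qed.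

Lemma tconsZ a c u : tcons a (c *: u) = c *: tcons a u.
Proof. by rewrite -[c *: u]addr0 tcons_linr (lin0 (tcons_linr a)) addr0. Qed.

Lemma tcons_linl u : linear (tcons^~ u).
Proof. by apply: fold_lin => b s; apply: tens_multilinear.1. Qed.

Lemma tcons_tens a b s : tcons a (tens b s) = tens a (b :: s).
Proof. exact: sh_fold_tens (tcons_ml a). Qed.

Definition sh_in (a : A) : shmod := tens a [::].

Lemma sh_in_lin : linear sh_in.
Proof. exact: tens_multilinear.1. Qed.

Lemma tens_ind (K : shmod -> Prop) :
  (forall a, K (sh_in a)) ->
  (forall a b s, K (tens b s) -> K (tcons a (tens b s))) ->
  forall a s, K (tens a s).
Proof.
move=> K0 K1 a s; elim: s a => [|b s IH] a; first exact: K0.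
by rewrite -tcons_tens; apply: K1.
Qed.

End TensorModule.

Section Shuffle.
Variables (k : comPzRingType) (lam : k) (A : calgType k).
Notation M := (shmod A).

(* The mixable shuffle product of the pure tensors a (x) s and b (x) t. *)
Fixpoint shw (s : seq A) : A -> A -> seq A -> M :=
  if s is a1 :: s' then
    fix shw_r (a b : A) (t : seq A) {struct t} : M :=
      if t is b1 :: t' then
        tcons (a * b) (shw s' a1 1 t + shw_r 1 b1 t' + lam *: shw s' a1 b1 t')
      else tens (a * b) s
  else fun a b t => tens (a * b) t.

Definition shword (a : A) (s : seq A) (b : A) (t : seq A) : M := shw s a b t.

Lemma shword_nill a b t : shword a [::] b t = tens (a * b) t.
Proof. by []. Qed.

Lemma shword_nilr a s b : shword a s b [::] = tens (a * b) s.
Proof. by case: s. Qed.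

Lemma shword_cons a a1 s b b1 t :
  shword a (a1 :: s) b (b1 :: t) =
  tcons (a * b) (shword a1 s 1 (b1 :: t) + shword 1 (a1 :: s) b1 t
                 + lam *: shword a1 s b1 t).
Proof. by []. Qed.

Lemma shwordC a s b t : shword a s b t = shword b t a s.
Proof.
elim: s a b t => [|a1 s IHs] a b t; first by rewrite shword_nilr mulrC.
elim: t a b => [|b1 t IHt] a b; first by rewrite shword_nilr mulrC.
by rewrite !shword_cons mulrC IHs IHt (IHs a1 b1 t) [X in X + _]addrC.
Qed.

Let mul_linl (b : A) : linear (fun a : A => a * b).
Proof. by move=> c x y; rewrite mulrDl calg_scalerAl. Qed.

Lemma shword_ml b t : multilinear (fun a s => shword a s b t).
Proof.
have H1 s : linear (fun a => shword a s b t).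
  case: s => [|a1 s]; first exact: (lin_comp ((tens_multilinear A).1 t) (mul_linl b)).
  case: t => [|b1 t]; last exact: (lin_comp (tcons_linl _) (mul_linl b)).
  exact: lin_comp ((tens_multilinear A).1 _) (mul_linl b).
split=> // a s1 s2.
elim: s1 a b t {H1} => [|a1 s1 IHs] a b t.
  elim: t a b => [|b1 t IHt] a b; first exact: (tens_multilinear A).2 _ [::] s2.
  apply: lin_comp; first exact: tcons_linr.
  have H1 c v : linear (fun x => shword x s2 c v).
    case: s2 {IHt} => [|a1 s]; first exact: lin_comp ((tens_multilinear A).1 v) (mul_linl c).
    case: v => [|b2 v]; last exact: (lin_comp (tcons_linl _) (mul_linl c)).
    exact: lin_comp ((tens_multilinear A).1 _) (mul_linl c).
  apply: lin_add; last by apply: lin_scale; exact: (H1 b1 t).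
  by apply: lin_add; [exact: (H1 1 (b1 :: t)) | exact: IHt].
elim: t a b => [|b1 t IHt] a b; first exact: (tens_multilinear A).2 _ (a1 :: s1) s2.
apply: lin_comp; first exact: tcons_linr.
apply: lin_add; last by apply: lin_scale; exact: (IHs a1 b1 t).
by apply: lin_add; [exact: (IHs a1 1 (b1 :: t)) | exact: IHt].
Qed.

Definition sh_mul (u v : M) : M :=
  sh_fold (fun a s => sh_fold (fun b t => shword a s b t) v) u.

Let mlr a s : multilinear (fun b t => shword a s b t).
Proof.
have [H1 H2] := shword_ml a s; split=> [t|b t1 t2] c x y.
  by rewrite !(shwordC a s); exact: H1.
by rewrite !(shwordC a s); exact: H2.
Qed.

Let mll v : multilinear (fun a s => sh_fold (fun b t => shword a s b t) v).
Proof.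
split=> [s|a s1 s2]; apply: fold_lin => b t; first exact: (shword_ml b t).1.
exact: (shword_ml b t).2.
Qed.

Lemma sh_mul_linl v : linear (sh_mul^~ v).
Proof. exact: sh_fold_linear (mll v). Qed.

Lemma sh_mul_linr u : linear (sh_mul u).
Proof. by apply: fold_lin => a s; exact: sh_fold_linear (mlr a s). Qed.

Lemma sh_mul_tens a s b t : sh_mul (tens a s) (tens b t) = shword a s b t.
Proof. by rewrite /sh_mul sh_fold_tens ?sh_fold_tens. Qed.

Lemma sh_mulC : commutative sh_mul.
Proof.
move=> u v; move: u; apply: sh_lin_ext => [||a s].
- exact: sh_mul_linl.
- exact: sh_mul_linr.
move: v; apply: sh_lin_ext => [||b t].
- exact: sh_mul_linr.
- exact: sh_mul_linl.
by rewrite !sh_mul_tens shwordC.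
Qed.

Lemma sh_mul_in a b t : sh_mul (sh_in a) (tens b t) = tens (a * b) t.
Proof. by rewrite sh_mul_tens. Qed.

Lemma sh_mul_in_tcons a b u : sh_mul (sh_in a) (tcons b u) = tcons (a * b) u.
Proof.
move: u; apply: sh_lin_ext => [||c s].
- exact: lin_comp (sh_mul_linr _) (tcons_linr b).
- exact: tcons_linr.
by rewrite !tcons_tens sh_mul_in.
Qed.

Lemma sh_mul_tcons a u b v : sh_mul (tcons a u) (tcons b v) =
  tcons (a * b) (sh_mul u (tcons 1 v) + sh_mul (tcons 1 u) v + lam *: sh_mul u v).
Proof.
move: u; apply: sh_lin_ext => [||a1 s].
- exact: lin_comp (sh_mul_linl _) (tcons_linr a).
- apply: (lin_comp (tcons_linr (a * b))).
  apply: lin_add; last by apply: lin_scale; exact: sh_mul_linl.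
  apply: lin_add; first exact: sh_mul_linl.
  exact: (lin_comp (sh_mul_linl v) (tcons_linr 1)).
move: v; apply: sh_lin_ext => [||b1 t].
- exact: lin_comp (sh_mul_linr _) (tcons_linr b).
- apply: (lin_comp (tcons_linr (a * b))).
  apply: lin_add; last by apply: lin_scale; exact: sh_mul_linr.
  apply: lin_add; last exact: sh_mul_linr.
  exact: (lin_comp (sh_mul_linr _) (tcons_linr 1)).
by rewrite !tcons_tens !sh_mul_tens shword_cons.
Qed.

Lemma sh_mul1 : left_id (sh_in 1) sh_mul.
Proof.
apply: sh_lin_ext => [||a s]; first exact: sh_mul_linr; first by [].
by rewrite sh_mul_in mul1r.
Qed.

Lemma sh_mulDl : left_distributive sh_mul +%R.
Proof. by move=> u v w; rewrite -[u]scale1r sh_mul_linl !scale1r. Qed.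

Lemma sh_scaleAl c u v : c *: sh_mul u v = sh_mul (c *: u) v.
Proof. by rewrite -[c *: u]addr0 sh_mul_linl (lin0 (sh_mul_linl v)) addr0. Qed.

Let sh_mulDr u v w : sh_mul u (v + w) = sh_mul u v + sh_mul u w.
Proof. by rewrite sh_mulC sh_mulDl ![sh_mul _ u]sh_mulC. Qed.
Let sh_scaleAr c u v : sh_mul u (c *: v) = c *: sh_mul u v.
Proof. by rewrite sh_mulC -sh_scaleAl sh_mulC. Qed.

Let sh_mulA_in a v w : sh_mul (sh_in a) (sh_mul v w) = sh_mul (sh_mul (sh_in a) v) w.
Proof.
move: v; apply: sh_lin_ext => [||b s].
- exact: lin_comp (sh_mul_linr _) (sh_mul_linl w).
- exact: lin_comp (sh_mul_linl w) (sh_mul_linr _).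
move: w; apply: sh_lin_ext => [||c t].
- exact: lin_comp (sh_mul_linr _) (sh_mul_linr _).
- exact: sh_mul_linr.
case: s => [|b1 s]; first by rewrite !sh_mul_in mulrA.
case: t => [|c1 t].
  rewrite sh_mul_in -!tcons_tens ![sh_mul _ (tens c [::])]sh_mulC.
  by rewrite !sh_mul_in_tcons mulrCA.
by rewrite -!tcons_tens sh_mul_in_tcons !sh_mul_tcons sh_mul_in_tcons mulrA.
Qed.

Lemma sh_mulA : associative sh_mul.
Proof.
have inA a v w := sh_mulA_in a v w.
have inAr u v c : sh_mul u (sh_mul v (sh_in c)) = sh_mul (sh_mul u v) (sh_in c).
  rewrite [sh_mul v _]sh_mulC [RHS]sh_mulC [LHS]sh_mulC -inA; congr sh_mul.
  exact: sh_mulC.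
have inAm u b w : sh_mul u (sh_mul (sh_in b) w) = sh_mul (sh_mul u (sh_in b)) w.
  rewrite [sh_mul u (sh_in b)]sh_mulC -inA [LHS]sh_mulC -inA; congr sh_mul.
  exact: sh_mulC.
suff Hn n a s b t c r : (size s + size t + size r < n)%N ->
    sh_mul (tens a s) (sh_mul (tens b t) (tens c r))
    = sh_mul (sh_mul (tens a s) (tens b t)) (tens c r).
  move=> u v w; move: u; apply: sh_lin_ext => [||a s].
  - exact: sh_mul_linl.
  - exact: lin_comp (sh_mul_linl w) (sh_mul_linl v).
  move: v; apply: sh_lin_ext => [||b t].
  - exact: lin_comp (sh_mul_linr _) (sh_mul_linl w).
  - exact: lin_comp (sh_mul_linl w) (sh_mul_linr _).
  move: w; apply: sh_lin_ext => [||c r].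
  - exact: lin_comp (sh_mul_linr _) (sh_mul_linr _).
  - exact: sh_mul_linr.
  exact: Hn.
elim: n a s b t c r => // n IH a [|a1 s] b [|b1 t] c [|c1 r] ltn;
  try exact: inA; try exact: inAm; try exact: inAr.
have Pmul u v : tcons 1 (sh_mul u (tcons 1 v) + sh_mul (tcons 1 u) v
    + lam *: sh_mul u v) = sh_mul (tcons 1 u) (tcons 1 v).
  by rewrite sh_mul_tcons mulr1.
rewrite -!tcons_tens !sh_mul_tcons !Pmul mulrA; congr tcons.
rewrite !sh_mulDr !sh_mulDl !sh_scaleAr -!sh_scaleAl !tcons_tens.
rewrite !IH; try by move: ltn => /=; lia.
by rewrite !scalerDr [LHS](AC (1*3*3) (1*2*5*3*(6*4*7))).
Qed.

Definition Sh : calgType k :=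
  CAlg sh_mulA sh_mulC sh_mul1 sh_mulDl sh_scaleAl.

Definition sh_incl : alg_hom A Sh :=
  @AlgHom k A Sh (@sh_in k A) (@sh_in_lin k A) erefl
    (fun a b => esym (sh_mul_in a b [::])).

Definition sh_P : {linear Sh -> Sh} :=
  HB.pack (tcons 1 : Sh -> Sh)
    (GRing.isLinear.Build k Sh Sh _ _ (@tcons_linr k A 1)).

Lemma sh_PE (u : Sh) : sh_P u = tcons 1 u.
Proof. by []. Qed.

Lemma sh_mulE (u v : Sh) : u * v = sh_mul u v.
Proof. by []. Qed.

Lemma sh_P_rb : is_rb lam sh_P.
Proof.
move=> u v; rewrite !sh_PE !sh_mulE sh_mul_tcons mulr1.
rewrite -[RHS]/(tcons 1 _ + tcons 1 _ + _) !tconsD tconsZ.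
by rewrite [X in X + _]addrC.
Qed.
End Shuffle.

Lemma mul_linr (k : comPzRingType) (A : calgType k) (x : A) :
  linear (fun y : A => x * y).
Proof. by move=> c y z; rewrite mulrDr calg_scalerAr. Qed.

Lemma mul_linl (k : comPzRingType) (A : calgType k) (x : A) :
  linear (fun y : A => y * x).
Proof. by move=> c y z; rewrite mulrDl calg_scalerAl. Qed.

Section ShuffleMaps.
Variables (k : comPzRingType) (lam : k).

Lemma sh_morph_mul (A B : calgType k) (f : Sh lam A -> B) (g : alg_hom A B)
    (Q : {linear B -> B}) :
  linear f -> is_rb lam Q -> (forall a, f (sh_in a) = g a) ->
  (forall a u, f (tcons a u) = g a * Q (f u)) ->
  forall u v, f (u * v) = f u * f v.
Proof.
move=> lf rbQ f0 f1.
have fD u v : f (u + v) = f u + f v by rewrite -[u]scale1r lf !scale1r.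
have fZ c u : f (c *: u) = c *: f u by rewrite -[c *: u]addr0 lf (lin0 lf) addr0.
suff Hn n a s b t : (size s + size t < n)%N ->
    f (sh_mul lam (tens a s) (tens b t)) = f (tens a s) * f (tens b t).
  move=> u v; rewrite sh_mulE; move: u; apply: sh_lin_ext => [||a s].
  - exact: (lin_comp lf (sh_mul_linl lam v)).
  - exact: (lin_comp (mul_linl _) lf).
  move: v; apply: sh_lin_ext => [||b t].
  - exact: (lin_comp lf (sh_mul_linr lam _)).
  - exact: (lin_comp (mul_linr _) lf).
  exact: Hn.
have Hin a0 b0 t0 : f (sh_mul lam (sh_in a0) (tens b0 t0)) = f (sh_in a0) * f (tens b0 t0).
  rewrite sh_mul_in f0; case: t0 => [|b1 t0]; first by rewrite !f0 alg_homM.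
  by rewrite -!tcons_tens !f1 alg_homM mulrA.
elim: n a s b t => // n IH a [|a1 s] b [|b1 t] ltn; try exact: Hin.
  by rewrite sh_mulC mulrC; exact: Hin.
rewrite -!tcons_tens sh_mul_tcons !f1 !fD fZ !tcons_tens !IH; try by move: ltn => /=; lia.
rewrite -!tcons_tens !f1 !alg_hom1 !mul1r alg_homM !linearD /= linearZ /=.
rewrite mulrACA rbQ; congr (_ * _); congr (_ + _); exact: addrC.
Qed.

Section Functor.
Variables (A B : calgType k) (phi : alg_hom A B).

Let ml : multilinear (fun a s => tens (phi a) (map phi s)).
Proof.
have lphi : linear phi by exact: alg_linear.
split=> [s|a s1 s2]; first exact: (lin_comp ((tens_multilinear B).1 _) lphi).
move=> c x y; rewrite !map_cat /= lphi; exact: (tens_multilinear B).2.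
Qed.

Definition sh_map_fun : Sh lam A -> Sh lam B :=
  sh_fold (fun a s => tens (phi a) (map phi s)).

Lemma sh_map_fun_tens a s : sh_map_fun (tens a s) = tens (phi a) (map phi s).
Proof. exact: sh_fold_tens ml. Qed.

Lemma sh_map_fun_lin : linear sh_map_fun.
Proof. exact: sh_fold_linear ml. Qed.

Lemma sh_map_fun_tcons a u :
  sh_map_fun (tcons a u) = tcons (phi a) (sh_map_fun u).
Proof.
move: u; apply: sh_lin_ext => [||b s].
- exact: (lin_comp sh_map_fun_lin (tcons_linr a)).
- exact: (lin_comp (tcons_linr _) sh_map_fun_lin).
by rewrite tcons_tens !sh_map_fun_tens tcons_tens.
Qed.

Let sh_map1 : sh_map_fun 1 = 1.
Proof. by rewrite sh_map_fun_tens alg_hom1. Qed.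

Let phi_in_lin : linear (fun a => sh_incl lam B (phi a)).
Proof. exact: (lin_comp (alg_linear _) (alg_linear phi)). Qed.
Let phi_in1 : sh_incl lam B (phi 1) = 1.
Proof. by rewrite !alg_hom1. Qed.
Let phi_inM x y :
  sh_incl lam B (phi (x * y)) = sh_incl lam B (phi x) * sh_incl lam B (phi y).
Proof. by rewrite !alg_homM. Qed.

Let sh_mapM u v : sh_map_fun (u * v) = sh_map_fun u * sh_map_fun v.
Proof.
pose g := AlgHom phi_in_lin phi_in1 phi_inM.
apply: (@sh_morph_mul A (Sh lam B) sh_map_fun g (sh_P lam B)).
- exact: sh_map_fun_lin.
- exact: sh_P_rb.
- by move=> a; rewrite sh_map_fun_tens.
- by move=> a w; rewrite sh_map_fun_tcons sh_PE sh_mulE sh_mul_in_tcons mulr1.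
Qed.

Definition sh_map : alg_hom (Sh lam A) (Sh lam B) :=
  AlgHom sh_map_fun_lin sh_map1 sh_mapM.

End Functor.

Section Evaluation.
Variables (R : calgType k) (P : {linear R -> R}) (rbP : is_rb lam P).

(* v_0 P(v_1 P(... P(v_m) ...)). *)
Fixpoint ev_word (a : R) (s : seq R) : R :=
  if s is b :: s' then a * P (ev_word b s') else a.

Let ml : multilinear ev_word.
Proof.
have H1 s : linear (fun a => ev_word a s).
  by case: s => [|b s] c x y //=; rewrite mulrDl calg_scalerAl.
split=> // a s1 s2; elim: s1 a => [|b s1 IH] a.
  exact: (lin_comp (mul_linr a) (lin_comp (linearP P) (H1 s2))).
exact: (lin_comp (mul_linr a) (lin_comp (linearP P) (IH b))).
Qed.

Definition sh_ev_fun : Sh lam R -> R := sh_fold ev_word.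

Lemma sh_ev_fun_tens a s : sh_ev_fun (tens a s) = ev_word a s.
Proof. exact: sh_fold_tens ml. Qed.

Lemma sh_ev_fun_lin : linear sh_ev_fun.
Proof. exact: sh_fold_linear ml. Qed.

Lemma sh_ev_fun_tcons a u : sh_ev_fun (tcons a u) = a * P (sh_ev_fun u).
Proof.
move: u; apply: sh_lin_ext => [||b s].
- exact: (lin_comp sh_ev_fun_lin (tcons_linr a)).
- exact: (lin_comp (mul_linr a) (lin_comp (linearP P) sh_ev_fun_lin)).
by rewrite tcons_tens !sh_ev_fun_tens.
Qed.

Let sh_ev1 : sh_ev_fun 1 = 1.
Proof. by rewrite sh_ev_fun_tens. Qed.

Let sh_evM u v : sh_ev_fun (u * v) = sh_ev_fun u * sh_ev_fun v.
Proof.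
pose g := @AlgHom k R R id (fun _ _ _ => erefl) erefl (fun _ _ => erefl).
apply: (@sh_morph_mul R R sh_ev_fun g P) => //.
- exact: sh_ev_fun_lin.
- by move=> a; rewrite sh_ev_fun_tens.
- exact: sh_ev_fun_tcons.
Qed.

Definition sh_ev : alg_hom (Sh lam R) R := AlgHom sh_ev_fun_lin sh_ev1 sh_evM.

End Evaluation.
End ShuffleMaps.

Section Filtration.
Variables (k : comPzRingType) (A : calgType k).

(* The sum of the tensor powers of degree 1, ..., n. *)
Definition sh_fil (n : nat) (u : shmod A) : Prop :=
  exists2 x : formal A, all (fun t => (size t.2.2 < n)%N) x &
    u = \sum_(t <- x) t.1 *: tens t.2.1 t.2.2.

Lemma fil_tens n a s : (size s < n)%N -> sh_fil n (tens a s).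
Proof.
by move=> lt; exists [:: (1, (a, s))]; rewrite /= ?lt // big_seq1 scale1r.
Qed.

Lemma fil_lin n c u v : sh_fil n u -> sh_fil n v -> sh_fil n (c *: u + v).
Proof.
move=> [x xn ->] [y yn ->]; exists ([seq (c * t.1, t.2) | t <- x] ++ y).
  by rewrite all_cat yn andbT all_map; apply: sub_all xn.
rewrite big_cat big_map scaler_sumr; congr (_ + _).
by apply: eq_bigr => t _; rewrite scalerA.
Qed.

Lemma fil0 n : sh_fil n 0.
Proof. by exists [::]; rewrite ?big_nil. Qed.

Lemma filD n u v : sh_fil n u -> sh_fil n v -> sh_fil n (u + v).
Proof. by rewrite -[u in sh_fil n (u + v)]scale1r; apply: fil_lin. Qed.

Lemma fil_mono m n u : (m <= n)%N -> sh_fil m u -> sh_fil n u.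
Proof.
move=> mn [x xm ->]; exists x => //; apply: sub_all xm => t /=.
by move/leq_trans; apply.
Qed.

Lemma fil_map n m (f : shmod A -> shmod A) : linear f ->
  (forall a s, (size s < n)%N -> sh_fil m (f (tens a s))) ->
  forall u, sh_fil n u -> sh_fil m (f u).
Proof.
move=> lf Hf u [x xn ->]; elim: x xn => [|t x IH] /=.
  by rewrite big_nil (lin0 lf) => _; exact: fil0.
case/andP=> tn xn; rewrite big_cons lf; apply: fil_lin; [exact: Hf | exact: IH].
Qed.

Lemma fil_eq n (N : lmodType k) (f g : shmod A -> N) : linear f -> linear g ->
  (forall a s, (size s < n)%N -> f (tens a s) = g (tens a s)) ->
  forall u, sh_fil n u -> f u = g u.
Proof.
move=> lf lg fg u [x xn ->]; elim: x xn => [|t x IH] /=.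
  by rewrite big_nil (lin0 lf) (lin0 lg).
by case/andP=> tn xn; rewrite big_cons lf lg IH // fg.
Qed.

Lemma fil_ex u : exists n, sh_fil n u.
Proof.
exists (\max_(t <- to_formal u) size t.2.2).+1; exists (to_formal u); last exact: sh_sum.
apply/allP => t tu; rewrite ltnS.
by rewrite (big_rem t tu) /= leq_maxl.
Qed.

Lemma fil_tcons n a u : sh_fil n u -> sh_fil n.+1 (tcons a u).
Proof.
apply: fil_map => [|b s lt]; first exact: tcons_linr.
by rewrite tcons_tens; apply: fil_tens.
Qed.

Lemma fil_in_mul (lam : k) n a u : sh_fil n u -> sh_fil n (sh_mul lam (sh_in a) u).
Proof.
apply: fil_map => [|b s lt]; first exact: sh_mul_linr.
by rewrite sh_mul_in; apply: fil_tens.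
Qed.

End Filtration.

Section Agree.
Variables (k : comPzRingType) (M : lmodType k) (K : M -> Prop).
Hypotheses (K0 : K 0) (Klin : forall c u v, K u -> K v -> K (c *: u + v)).

Lemma iter_agree (f g : M -> M) n u :
  (forall u, K u -> f u = g u /\ K (f u)) -> K u ->
  iter n f u = iter n g u /\ K (iter n f u).
Proof.
move=> fg Ku; elim: n => [|n [E KE]] //=.
by have [E1 K1] := fg _ KE; rewrite -E.
Qed.

Lemma peval_agree (f g : M -> M) p u :
  (forall u, K u -> f u = g u /\ K (f u)) -> K u ->
  peval p f u = peval p g u /\ K (peval p f u).
Proof.
move=> fg Ku; split.
  by apply: eq_bigr => i _; rewrite (iter_agree i fg Ku).1.
rewrite /peval; elim: (index_enum _) => [|i r IH]; first by rewrite big_nil.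
rewrite big_cons; apply: Klin => //; exact: (iter_agree i fg Ku).2.
Qed.

End Agree.

Section Extension.
Variables (k : comPzRingType) (lam : k) (w : omega k).

(* The three conditions characterising the canonical extension of q;
   existence and uniqueness are ext_is_ext and ext_unique. *)
Definition is_ext (R : calgType k) (q : R -> R)
    (qh : Sh lam R -> Sh lam R) : Prop :=
  [/\ forall a, qh (sh_incl lam R a) = sh_incl lam R (q a),
      forall n u, sh_fil n u -> sh_fil n (qh u)
    & forall u0 (u' : Sh lam R), qh (tcons u0 u') =
        tcons (q u0) u' + sh_incl lam R (u0 + lam *: q u0) *
          (peval (om_phi w) qh u' + sh_P lam R (peval (om_psi w) qh u'))].

Section Construction.
Variables (R : calgType k) (q : {linear R -> R}).
Notation S := (Sh lam R).

Definition q_tail (f : S -> S) (a : R) (u : S) : S :=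
  tcons (q a) u + sh_incl lam R (a + lam *: q a) *
    (peval (om_phi w) f u + sh_P lam R (peval (om_psi w) f u)).

(* The recursive formula computes the extension on words of length n+1 from
   its iterates on words of length at most n: q_stage n is correct on words of
   length at most n+1. *)
Fixpoint q_stage (n : nat) : S -> S :=
  sh_fold (fun a s =>
    if s is b :: t then
      if n is n'.+1 then q_tail (q_stage n') a (tens b t) else 0 : S
    else sh_incl lam R (q a)).

Lemma q_tail_linl f u : linear (fun a => q_tail f a u).
Proof.
apply: lin_add; first exact: (lin_comp (tcons_linl u) (linearP q)).
apply: (lin_comp (mul_linl _)); apply: (lin_comp (alg_linear _)).
by apply: lin_add => //; apply: lin_scale; exact: linearP.
Qed.

Lemma q_tail_linr f a : linear f -> linear (q_tail f a).
Proof.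
move=> lf; apply: lin_add; first exact: tcons_linr.
apply: (lin_comp (mul_linr _)); apply: lin_add; first exact: peval_lin.
exact: (lin_comp (linearP (sh_P lam R)) (peval_lin _ lf)).
Qed.

Definition q_word n a (s : seq R) : S :=
    if s is b :: t then
      if n is n'.+1 then q_tail (q_stage n') a (tens b t) else 0 : S
    else sh_incl lam R (q a).

Lemma q_stageE n : q_stage n = sh_fold (q_word n).
Proof. by case: n. Qed.

Lemma q_word_ml n : multilinear (q_word n).
Proof.
elim: n => [|n IH].
  split=> [[|b s]|a [|b s1] s2];
    first exact: (lin_comp (alg_linear (sh_incl lam R)) (linearP q));
    by move=> c x y; rewrite /= scaler0 addr0.
have lf : linear (q_stage n) by rewrite q_stageE; exact: sh_fold_linear IH.
split=> [[|b s]|a [|b s1] s2].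
- exact: (lin_comp (alg_linear (sh_incl lam R)) (linearP q)).
- exact: q_tail_linl.
- exact: (lin_comp (q_tail_linr a lf) ((tens_multilinear R).1 s2)).
- exact: (lin_comp (q_tail_linr a lf) ((tens_multilinear R).2 b s1 s2)).
Qed.

Lemma q_stage_lin n : linear (q_stage n).
Proof. by rewrite q_stageE; exact: sh_fold_linear (q_word_ml n). Qed.

Lemma q_stage_tens n a s : q_stage n (tens a s) = q_word n a s.
Proof. by rewrite q_stageE; exact: sh_fold_tens (q_word_ml n). Qed.

Lemma q_tail_agree n f g a u :
  (forall u, sh_fil n u -> f u = g u /\ sh_fil n (f u)) -> sh_fil n u ->
  q_tail f a u = q_tail g a u /\ sh_fil n.+1 (q_tail f a u).
Proof.
move=> fg un; rewrite /q_tail.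
have [E1 F1] := peval_agree (@fil0 _ _ n) (@fil_lin _ _ n) (om_phi w) fg un.
have [E2 F2] := peval_agree (@fil0 _ _ n) (@fil_lin _ _ n) (om_psi w) fg un.
split; first by rewrite -E1 -E2.
apply: filD; first exact: fil_tcons.
apply: fil_in_mul; apply: filD; first exact: fil_mono F1.
exact: fil_tcons.
Qed.

Lemma q_stage_agree j a s n m : (size s < j)%N -> (size s <= n)%N ->
  (size s <= m)%N -> q_stage n (tens a s) = q_stage m (tens a s) /\
  sh_fil (size s).+1 (q_stage n (tens a s)).
Proof.
elim: j a s n m => // j IH a s n m sj sn sm; rewrite !q_stage_tens.
case: s sj sn sm => [|b t] /=; first by move=> *; split => //; exact: fil_tens.
case: n => // n; case: m => // m; rewrite !ltnS => tj tn tm /=.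
apply: q_tail_agree; last exact: fil_tens.
move=> u un; split.
  apply: (fil_eq (q_stage_lin n) (q_stage_lin m) _ un) => c r rt.
  by apply: (IH c r n m _ _ _).1; lia.
apply: (fil_map (q_stage_lin n) _ un) => c r rt.
by apply: fil_mono (IH c r n n _ _ _).2; lia.
Qed.

Definition ext_fun : S -> S := sh_fold (fun a s => q_stage (size s) (tens a s)).

Let ext_ml : multilinear (fun a s => q_stage (size s) (tens a s)).
Proof.
split=> [s|a s1 s2].
  exact: (lin_comp (q_stage_lin _) ((tens_multilinear R).1 s)).
move=> c x y; rewrite !size_cat /=.
exact: (lin_comp (q_stage_lin _) ((tens_multilinear R).2 a s1 s2)).
Qed.

Lemma ext_lin : linear ext_fun.
Proof. exact: sh_fold_linear ext_ml. Qed.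

Lemma ext_tens a s : ext_fun (tens a s) = q_stage (size s) (tens a s).
Proof. exact: sh_fold_tens ext_ml. Qed.

Lemma ext_agree n u : sh_fil n.+1 u ->
  q_stage n u = ext_fun u /\ sh_fil n.+1 (q_stage n u).
Proof.
move=> un; split.
  apply: (fil_eq (q_stage_lin n) ext_lin _ un) => a s sn.
  by rewrite ext_tens; apply: (@q_stage_agree (size s).+1 _ _ _ _ _ _ _).1.
apply: (fil_map (q_stage_lin n) _ un) => a s sn.
by apply: fil_mono (@q_stage_agree (size s).+1 a s n n _ _ _).2.
Qed.

Definition canon_ext : {linear S -> S} :=
  HB.pack ext_fun (GRing.isLinear.Build k S S _ ext_fun ext_lin).

Lemma ext_is_ext : is_ext q canon_ext.
Proof.
split.
- by move=> a; rewrite [LHS]ext_tens q_stage_tens.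
- move=> [|n] u; last first.
    by move=> un; have [E F] := ext_agree un; rewrite -[canon_ext u]/(ext_fun u) -E.
  by case=> [[|t x]] // _ ->; rewrite big_nil linear0; exact: fil0.
- move=> u0; apply: sh_lin_ext => [||b t].
  + exact: (lin_comp ext_lin (tcons_linr u0)).
  + exact: q_tail_linr ext_lin.
  rewrite tcons_tens [LHS]ext_tens q_stage_tens /=.
  by apply: (q_tail_agree u0 (@ext_agree (size t)) _).1; exact: fil_tens.
Qed.

Lemma ext_unique (qh : {linear S -> S}) : is_ext q qh -> qh = canon_ext.
Proof.
move=> [h1 h2 h3]; have [e1 e2 e3] := ext_is_ext.
suff H n u : sh_fil n u -> qh u = canon_ext u.
  by apply: linear_ext => u; have [n] := fil_ex u; exact: H.
elim: n u => [|n IH] u un.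
  by apply: (fil_eq (linearP qh) (linearP canon_ext) _ un).
apply: (fil_eq (linearP qh) (linearP canon_ext) _ un) => a [|b s]; first by rewrite h1 e1.
move=> sn; rewrite -tcons_tens h3 e3.
apply: (q_tail_agree (n := n) (f := qh) (g := canon_ext) a _ _).1; last exact: fil_tens.
by move=> v vn; rewrite IH //; split => //; apply: e2.
Qed.

Hypothesis q1 : q 1 = 0.

Lemma ext1 : canon_ext 1 = 0.
Proof. by have [e _ _] := ext_is_ext; rewrite [LHS]e q1 linear0. Qed.

Lemma ext_of_type : of_type w canon_ext (sh_P lam R).
Proof.
move=> u; have [_ _ e] := ext_is_ext.
rewrite [LHS]e q1 scaler0 addr0 alg_hom1 mul1r.
by rewrite (lin0 (tcons_linl u)) add0r.
Qed.

End Construction.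

Lemma ext_map (R R' : calgType k) (q : {linear R -> R}) (q' : {linear R' -> R'})
    (phi : alg_hom R R') (phiq : forall x, phi (q x) = q' (phi x)) u :
  sh_map lam phi (canon_ext q u) = canon_ext q' (sh_map lam phi u).
Proof.
set T := sh_map lam phi.
have lT : linear T by exact: alg_linear.
have [e1 e2 e3] := ext_is_ext q; have [f1 f2 f3] := ext_is_ext q'.
have Tin a : T (sh_incl lam R a) = sh_incl lam R' (phi a).
  by rewrite [LHS]sh_map_fun_tens.
have Tcons a v : T (tcons a v) = tcons (phi a) (T v) by exact: sh_map_fun_tcons.
have TZ c x : T (c *: x) = c *: T x by rewrite -[c *: x]addr0 lT (lin0 lT) addr0.
have TD x y : T (x + y) = T x + T y by rewrite -[x]scale1r lT !scale1r.
have lL := lin_comp lT (linearP (canon_ext q)).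
have lR := lin_comp (linearP (canon_ext q')) lT.
have [n un] := fil_ex u; elim: n u un => [|n IH] u un; apply: (fil_eq lL lR _ un) => //.
move=> a [|b s] sn; first by rewrite e1 !Tin f1 phiq.
have Hit i v : sh_fil n v -> T (iter i (canon_ext q) v) = iter i (canon_ext q') (T v).
  move=> vn; have [_ vin] : iter i (canon_ext q) v = iter i (canon_ext q) v /\ sh_fil n (iter i (canon_ext q) v).
    by apply: iter_agree => // x xn; split => //; apply: e2.
  elim: i vin => [|i IHi] // _.
  have vin : sh_fil n (iter i (canon_ext q) v).
    have [_ //] : iter i (canon_ext q) v = iter i (canon_ext q) v /\ sh_fil n (iter i (canon_ext q) v).
    by apply: iter_agree => // x xn; split => //; apply: e2.
  by rewrite !iterS IH // IHi.
have Hpev p v : sh_fil n v -> T (peval p (canon_ext q) v) = peval p (canon_ext q') (T v).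
  move=> vn; rewrite /peval (big_morph T TD (lin0 lT)); apply: eq_bigr => i _.
  by rewrite TZ Hit.
have tn : sh_fil n (tens b s) by exact: fil_tens.
rewrite -tcons_tens e3 Tcons f3 -!Hpev // TD Tcons phiq; congr (_ + _).
rewrite [LHS]alg_homM Tin linearD /= linearZ /= phiq; congr (_ * _).
rewrite -/T [LHS]TD; congr (_ + _).
by rewrite -[LHS]/(T (tcons 1 _)) Tcons alg_hom1.
Qed.

End Extension.

Record category := Category {
  ob :> Type;
  mor : ob -> ob -> Type;
  idm : forall x, mor x x;
  compm : forall x y z, mor y z -> mor x y -> mor x z;
  compmA : forall w x y z (h : mor y z) (g : mor x y) (f : mor w x),
    compm h (compm g f) = compm (compm h g) f;
  comp1m : forall x y (f : mor x y), compm (idm y) f = f;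
  compm1 : forall x y (f : mor x y), compm f (idm x) = f
}.
Arguments mor {c}.
Arguments idm {c}.
Notation "g \c f" := (compm g f) (at level 50, left associativity).

(* Equality of morphisms whose sources and targets are equal without being
   convertible is stated as equality of arrows (source, target, morphism). *)
Record arrow (C : category) := Arrow {
  src : C; tgt : C; arr : mor src tgt
}.
Arguments Arrow {C src tgt}.

Record functor (C D : category) := Functor {
  fob :> C -> D;
  fmap : forall x y, mor x y -> mor (fob x) (fob y);
  fmap_id : forall x, fmap (idm x) = idm (fob x);
  fmap_comp : forall x y z (g : mor y z) (f : mor x y),
    fmap (g \c f) = fmap g \c fmap f
}.
Arguments fmap {C D} _ {x y}.

Definition id_functor (C : category) : functor C C :=
  @Functor C C id (fun _ _ f => f) (fun=> erefl) (fun _ _ _ _ _ => erefl).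

Definition comp_functor (C D E : category) (G : functor D E) (F : functor C D) :
  functor C E.
Proof.
refine (@Functor C E (fun x => G (F x)) (fun x y f => fmap G (fmap F f)) _ _).
- by move=> x; rewrite !fmap_id.
- by move=> x y z g f; rewrite !fmap_comp.
Defined.
Notation "G \F F" := (comp_functor G F) (at level 50, left associativity).

Definition functor_eq (C D : category) (F G : functor C D) : Prop :=
  (forall x, F x = G x) /\
  (forall x y (f : mor x y), Arrow (fmap F f) = Arrow (fmap G f)).

Definition is_cat_iso (C D : category) (F : functor C D) : Prop :=
  exists G : functor D C,
    functor_eq (G \F F) (id_functor C) /\ functor_eq (F \F G) (id_functor D).

Record nat_trans (C D : category) (F G : functor C D) := NatTrans {
  ncomp :> forall x, mor (F x) (G x);
  naturality : forall x y (f : mor x y), ncomp y \c fmap F f = fmap G f \c ncomp x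
}.

Record comonad (C : category) := Comonad {
  comonad_fun :> functor C C;
  wcounit : nat_trans comonad_fun (id_functor C);
  wcomult : nat_trans comonad_fun (comonad_fun \F comonad_fun);
  comonad_counitl : forall x, wcounit (comonad_fun x) \c wcomult x = idm _;
  comonad_counitr : forall x, fmap comonad_fun (wcounit x) \c wcomult x = idm _;
  comonad_coassoc : forall x,
    wcomult (comonad_fun x) \c wcomult x = fmap comonad_fun (wcomult x) \c wcomult x
}.

Record monad (C : category) := Monad {
  monad_fun :> functor C C;
  munit : nat_trans (id_functor C) monad_fun;
  mmult : nat_trans (monad_fun \F monad_fun) monad_fun;
  monad_unitl : forall x, mmult x \c munit (monad_fun x) = idm _;
  monad_unitr : forall x, mmult x \c fmap monad_fun (munit x) = idm _;
  monad_assoc : forall x,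
    mmult x \c mmult (monad_fun x) = mmult x \c fmap monad_fun (mmult x)
}.

Section Coalgebras.
Variables (C : category) (W : comonad C).

Record coalgebra := Coalgebra {
  coalg_car : C;
  coalg_map : mor coalg_car (W coalg_car);
  coalg_counit : wcounit W _ \c coalg_map = idm _;
  coalg_coassoc : wcomult W _ \c coalg_map = fmap W coalg_map \c coalg_map
}.

Record coalg_hom (X Y : coalgebra) := CoalgHom {
  coalg_mor : mor (coalg_car X) (coalg_car Y);
  coalg_morP : fmap W coalg_mor \c coalg_map X = coalg_map Y \c coalg_mor
}.

Lemma coalg_hom_ext X Y (f g : coalg_hom X Y) :
  coalg_mor f = coalg_mor g -> f = g.
Proof.
case: f g => [f fP] [g gP] /= fg; subst g.
by congr CoalgHom; exact: Prop_irrelevance.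
Qed.

Definition coalg_id (X : coalgebra) : coalg_hom X X.
Proof. by exists (idm _); rewrite fmap_id comp1m compm1. Defined.

Definition coalg_comp (X Y Z : coalgebra) (g : coalg_hom Y Z)
  (f : coalg_hom X Y) : coalg_hom X Z.
Proof.
exists (coalg_mor g \c coalg_mor f).
by rewrite fmap_comp -compmA coalg_morP compmA coalg_morP compmA.
Defined.

Definition coalg_cat : category.
Proof.
refine (@Category coalgebra coalg_hom coalg_id coalg_comp _ _ _).
- by move=> *; apply: coalg_hom_ext; exact: compmA.
- by move=> *; apply: coalg_hom_ext; exact: comp1m.
- by move=> *; apply: coalg_hom_ext; exact: compm1.
Defined.

Definition coalg_forget : functor coalg_cat C :=
  @Functor coalg_cat C coalg_car coalg_mor (fun=> erefl) (fun _ _ _ _ _ => erefl).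

End Coalgebras.

Section Algebras.
Variables (C : category) (T : monad C).

Record algebra := Algebra {
  alg_car : C;
  alg_map : mor (T alg_car) alg_car;
  alg_unit : alg_map \c munit T _ = idm _;
  alg_assoc : alg_map \c mmult T _ = alg_map \c fmap T alg_map
}.

Record algebra_hom (X Y : algebra) := AlgebraHom {
  alg_mor : mor (alg_car X) (alg_car Y);
  alg_morP : alg_mor \c alg_map X = alg_map Y \c fmap T alg_mor
}.

Lemma algebra_hom_ext X Y (f g : algebra_hom X Y) :
  alg_mor f = alg_mor g -> f = g.
Proof.
case: f g => [f fP] [g gP] /= fg; subst g.
by congr AlgebraHom; exact: Prop_irrelevance.
Qed.

Definition algebra_id (X : algebra) : algebra_hom X X.
Proof. by exists (idm _); rewrite fmap_id comp1m compm1. Defined.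

Definition algebra_comp (X Y Z : algebra) (g : algebra_hom Y Z)
  (f : algebra_hom X Y) : algebra_hom X Z.
Proof.
exists (alg_mor g \c alg_mor f).
by rewrite fmap_comp -compmA alg_morP compmA alg_morP compmA.
Defined.

Definition alg_cat : category.
Proof.
refine (@Category algebra algebra_hom algebra_id algebra_comp _ _ _).
- by move=> *; apply: algebra_hom_ext; exact: compmA.
- by move=> *; apply: algebra_hom_ext; exact: comp1m.
- by move=> *; apply: algebra_hom_ext; exact: compm1.
Defined.

Definition alg_forget : functor alg_cat C :=
  @Functor alg_cat C alg_car alg_mor (fun=> erefl) (fun _ _ _ _ _ => erefl).

End Algebras.

Record lifts_comonad (C D : category) (U : functor D C) (W : comonad C)
    (W' : comonad D) : Prop := LiftsComonad {
  lift_cofun : functor_eq (U \F W') (W \F U);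
  lift_counit : forall X : D, Arrow (fmap U (wcounit W' X)) = Arrow (wcounit W (U X));
  lift_comult : forall X : D, Arrow (fmap U (wcomult W' X)) = Arrow (wcomult W (U X))
}.

Record lifts_monad (C D : category) (V : functor D C) (T : monad C)
    (T' : monad D) : Prop := LiftsMonad {
  lift_fun : functor_eq (V \F T') (T \F V);
  lift_unit : forall X : D, Arrow (fmap V (munit T' X)) = Arrow (munit T (V X));
  lift_mult : forall X : D, Arrow (fmap V (mmult T' X)) = Arrow (mmult T (V X))
}.

Record mixed_law (C : category) (T : monad C) (W : comonad C) := MixedLaw {
  law :> nat_trans (T \F W) (W \F T);
  law_unit : forall x, law x \c munit T (W x) = fmap W (munit T x);
  law_counit : forall x, wcounit W (T x) \c law x = fmap T (wcounit W x);
  law_comult : forall x, wcomult W (T x) \c law x =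
    fmap W (law x) \c law (W x) \c fmap T (wcomult W x);
  law_mult : forall x, law x \c mmult T (W x) =
    fmap W (mmult T x) \c law (T x) \c fmap T (law x)
}.

Section LiftByLaw.
Variables (C : category) (T : monad C) (W : comonad C) (b : mixed_law T W).

(* <A, f> |-> <T A, b_A o T f>. *)
Definition lift_coalg (X : coalg_cat W) : coalg_cat W.
Proof.
refine (@Coalgebra C W (T (coalg_car X)) (b _ \c fmap T (coalg_map X)) _ _).
- by rewrite compmA law_counit -fmap_comp coalg_counit fmap_id.
- have E : fmap T (wcomult W _) \c fmap T (coalg_map X) =
      fmap T (fmap W (coalg_map X)) \c fmap T (coalg_map X).
    by rewrite -(fmap_comp T) coalg_coassoc (fmap_comp T).
  have N : b _ \c fmap T (fmap W (coalg_map X)) =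
      fmap W (fmap T (coalg_map X)) \c b _ := naturality b (coalg_map X).
  rewrite compmA law_comult -[LHS]compmA E compmA -[X in X \c _]compmA N.
  by rewrite fmap_comp !compmA.
Defined.

Definition lift_coalg_hom (X Y : coalg_cat W) (f : mor X Y) :
  mor (lift_coalg X) (lift_coalg Y).
Proof.
refine (@CoalgHom C W (lift_coalg X) (lift_coalg Y) (fmap T (coalg_mor f)) _).
have N : b _ \c fmap T (fmap W (coalg_mor f)) =
    fmap W (fmap T (coalg_mor f)) \c b _ := naturality b (coalg_mor f).
by rewrite /= [LHS]compmA -N -[LHS]compmA -(fmap_comp T) coalg_morP (fmap_comp T) compmA.
Defined.

Definition lift_functor : functor (coalg_cat W) (coalg_cat W).
Proof.
refine (@Functor (coalg_cat W) (coalg_cat W) lift_coalg lift_coalg_hom _ _).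
- by move=> X; apply: coalg_hom_ext; exact: fmap_id.
- by move=> X Y Z g f; apply: coalg_hom_ext; exact: fmap_comp.
Defined.

Definition lift_unit_nat : nat_trans (id_functor (coalg_cat W)) lift_functor.
Proof.
unshelve refine (@NatTrans _ _ (id_functor (coalg_cat W)) lift_functor _ _).
- move=> X; refine (@CoalgHom C W X (lift_functor X) (munit T (coalg_car X)) _).
  have N : munit T _ \c coalg_map X = fmap T (coalg_map X) \c munit T _ :=
    naturality (munit T) (coalg_map X).
  by rewrite /= -(law_unit b) -[LHS]compmA N compmA.
- by move=> X Y f; apply: coalg_hom_ext; exact: (naturality (munit T)).
Defined.

Definition lift_mult_nat : nat_trans (lift_functor \F lift_functor) lift_functor.
Proof.
unshelve refine (@NatTrans _ _ (lift_functor \F lift_functor) lift_functor _ _).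
- move=> X.
  refine (@CoalgHom C W (lift_functor (lift_functor X)) (lift_functor X)
    (mmult T (coalg_car X)) _).
  have N : mmult T _ \c fmap T (fmap T (coalg_map X)) =
      fmap T (coalg_map X) \c mmult T _ := naturality (mmult T) (coalg_map X).
  by rewrite /= fmap_comp !compmA -(law_mult b) -[LHS]compmA N compmA.
- by move=> X Y f; apply: coalg_hom_ext; exact: (naturality (mmult T)).
Defined.

Definition lift_monad : monad (coalg_cat W).
Proof.
refine (@Monad _ lift_functor lift_unit_nat lift_mult_nat _ _ _).
- by move=> X; apply: coalg_hom_ext; exact: monad_unitl.
- by move=> X; apply: coalg_hom_ext; exact: monad_unitr.
- by move=> X; apply: coalg_hom_ext; exact: monad_assoc.
Defined.

End LiftByLaw.

Definition alg_id (k : comPzRingType) (A : calgType k) : alg_hom A A :=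
  @AlgHom k A A id (fun _ _ _ => erefl) erefl (fun _ _ => erefl).

Definition alg_comp (k : comPzRingType) (A B D : calgType k)
  (g : alg_hom B D) (f : alg_hom A B) : alg_hom A D.
Proof.
refine (@AlgHom k A D (fun x => g (f x)) _ _ _).
- exact: (lin_comp (alg_linear g) (alg_linear f)).
- by rewrite !alg_hom1.
- by move=> x y; rewrite !alg_homM.
Defined.

Definition ALG (k : comPzRingType) : category.
Proof.
by refine (@Category (calgType k) (@alg_hom k) (@alg_id k) (@alg_comp k) _ _ _);
  move=> *; apply: alg_hom_ext.
Defined.

Record op_hom (k : comPzRingType) (A B : calgType k) (q : A -> A) (q' : B -> B) :=
  OpHom {
    op_mor :> alg_hom A B;
    op_morP : forall x, op_mor (q x) = q' (op_mor x)
  }.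

Lemma op_hom_ext (k : comPzRingType) (A B : calgType k) (q : A -> A)
  (q' : B -> B) (f g : op_hom q q') : op_mor f = op_mor g -> f = g.
Proof.
case: f g => [f fP] [g gP] /= fg; subst g.
by congr OpHom; exact: Prop_irrelevance.
Qed.

Record op2_hom (k : comPzRingType) (A B : calgType k) (q p : A -> A)
  (q' p' : B -> B) := Op2Hom {
    op2_mor :> alg_hom A B;
    op2_morP1 : forall x, op2_mor (q x) = q' (op2_mor x);
    op2_morP2 : forall x, op2_mor (p x) = p' (op2_mor x)
  }.

Lemma op2_hom_ext (k : comPzRingType) (A B : calgType k) (q p : A -> A)
  (q' p' : B -> B) (f g : op2_hom q p q' p') : op2_mor f = op2_mor g -> f = g.
Proof.
case: f g => [f fP1 fP2] [g gP1 gP2] /= fg; subst g.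
by congr Op2Hom; exact: Prop_irrelevance.
Qed.

Section OperatorCategories.
Variable k : comPzRingType.

Definition op_prop := forall R : calgType k, {linear R -> R} -> Prop.
Definition op2_prop :=
  forall R : calgType k, {linear R -> R} -> {linear R -> R} -> Prop.

Record op_alg (K : op_prop) := OpAlg {
  oa_car : calgType k;
  oa_op : {linear oa_car -> oa_car};
  oa_opP : K oa_car oa_op
}.

Record op2_alg (K : op2_prop) := Op2Alg {
  o2_car : calgType k;
  o2_op1 : {linear o2_car -> o2_car};
  o2_op2 : {linear o2_car -> o2_car};
  o2_opP : K o2_car o2_op1 o2_op2
}.

Definition op_cat (K : op_prop) : category.
Proof.
unshelve refine (@Category (op_alg K) (fun X Y => op_hom (oa_op X) (oa_op Y))
  (fun X => @OpHom k _ _ (oa_op X) (oa_op X) (alg_id _) (fun=> erefl)) _ _ _ _).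
- move=> X Y Z g f; exists (alg_comp g f) => x /=.
  by rewrite !op_morP.
- by move=> *; apply: op_hom_ext; exact: (@compmA (ALG k)).
- by move=> *; apply: op_hom_ext; exact: (@comp1m (ALG k)).
- by move=> *; apply: op_hom_ext; exact: (@compm1 (ALG k)).
Defined.

Definition op2_cat (K : op2_prop) : category.
Proof.
unshelve refine (@Category (op2_alg K)
  (fun X Y => op2_hom (o2_op1 X) (o2_op2 X) (o2_op1 Y) (o2_op2 Y))
  (fun X => @Op2Hom k _ _ (o2_op1 X) (o2_op2 X) (o2_op1 X) (o2_op2 X)
     (alg_id _) (fun=> erefl) (fun=> erefl)) _ _ _ _).
- move=> X Y Z g f; exists (alg_comp g f) => x /=.
    by rewrite !op2_morP1.
  by rewrite !op2_morP2.
- by move=> *; apply: op2_hom_ext; exact: (@compmA (ALG k)).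
- by move=> *; apply: op2_hom_ext; exact: (@comp1m (ALG k)).
- by move=> *; apply: op2_hom_ext; exact: (@compm1 (ALG k)).
Defined.

Definition op_forget (K : op_prop) : functor (op_cat K) (ALG k) :=
  @Functor (op_cat K) (ALG k) (@oa_car K) (fun _ _ f => op_mor f)
    (fun=> erefl) (fun _ _ _ _ _ => erefl).

Definition op_incl (K L : op_prop) (KL : forall R q, K R q -> L R q) :
  functor (op_cat K) (op_cat L) :=
  @Functor (op_cat K) (op_cat L) (fun X => OpAlg (KL _ _ (oa_opP X)))
    (fun _ _ f => f) (fun=> erefl) (fun _ _ _ _ _ => erefl).

Definition op2_incl (K L : op2_prop) (KL : forall R q p, K R q p -> L R q p) :
  functor (op2_cat K) (op2_cat L) :=
  @Functor (op2_cat K) (op2_cat L) (fun X => Op2Alg (KL _ _ _ (o2_opP X)))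
    (fun _ _ f => f) (fun=> erefl) (fun _ _ _ _ _ => erefl).

Definition op2_fst (K : op2_prop) (L : op_prop)
  (KL : forall R q p, K R q p -> L R q) : functor (op2_cat K) (op_cat L).
Proof.
unshelve refine (@Functor (op2_cat K) (op_cat L)
  (fun X => OpAlg (KL _ _ _ (o2_opP X))) (fun _ _ f => OpHom (op2_morP1 f)) _ _).
- by move=> X; apply: op_hom_ext.
- by move=> *; apply: op_hom_ext.
Defined.

Definition op2_snd (K : op2_prop) (L : op_prop)
  (KL : forall R q p, K R q p -> L R p) : functor (op2_cat K) (op_cat L).
Proof.
unshelve refine (@Functor (op2_cat K) (op_cat L)
  (fun X => OpAlg (KL _ _ _ (o2_opP X))) (fun _ _ f => OpHom (op2_morP2 f)) _ _).
- by move=> X; apply: op_hom_ext.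
- by move=> *; apply: op_hom_ext.
Defined.

End OperatorCategories.

Section TheCategories.
Variables (k : comPzRingType) (lam : k) (w : omega k).

Definition oda_prop : op2_prop k := fun R d Q => is_diff lam d /\ of_type w d Q.
Definition orb_prop : op2_prop k :=
  fun R q P => [/\ q 1 = 0, is_rb lam P & of_type w q P].
Definition drb_prop : op2_prop k :=
  fun R d P => [/\ is_diff lam d, is_rb lam P & of_type w d P].

Definition OA : category := op_cat (fun (R : calgType k) _ => True).
Definition OA0 : category := op_cat (fun (R : calgType k) q => q 1 = 0).
Definition DIF : category := op_cat (@is_diff k lam).
Definition RBA : category := op_cat (@is_rb k lam).
Definition ODA : category := op2_cat oda_prop.
Definition ORB : category := op2_cat orb_prop.
Definition DRB : category := op2_cat drb_prop.

Definition RBA_ALG : functor RBA (ALG k) := op_forget (@is_rb k lam).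
Definition DIF_ALG : functor DIF (ALG k) := op_forget (@is_diff k lam).

Definition RBA_OA : functor RBA OA :=
  @op_incl k (@is_rb k lam) (fun R _ => True) (fun _ _ _ => I).
Definition DIF_OA0 : functor DIF OA0 :=
  @op_incl k (@is_diff k lam) (fun R q => q 1 = 0) (fun _ _ dP => dP.2).

Lemma drb_oda (R : calgType k) (d P : {linear R -> R}) :
  drb_prop d P -> oda_prop d P.
Proof. by case. Qed.
Lemma drb_orb (R : calgType k) (d P : {linear R -> R}) :
  drb_prop d P -> orb_prop d P.
Proof. by case=> -[]. Qed.
Lemma drb_dif (R : calgType k) (d P : {linear R -> R}) :
  drb_prop d P -> is_diff lam d.
Proof. by case. Qed.
Lemma drb_rba (R : calgType k) (d P : {linear R -> R}) :
  drb_prop d P -> is_rb lam P.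
Proof. by case. Qed.

Definition DRB_ODA : functor DRB ODA := op2_incl (@drb_oda).
Definition DRB_ORB : functor DRB ORB := op2_incl (@drb_orb).
Definition DRB_DIF : functor DRB DIF := op2_fst (@drb_dif).
Definition DRB_RBA : functor DRB RBA := op2_snd (@drb_rba).

Lemma morph_peval (A B : calgType k) (f : alg_hom A B) (q : A -> A) (q' : B -> B)
  (fq : forall x, f (q x) = q' (f x)) p x :
  f (peval p q x) = peval p q' (f x).
Proof.
rewrite /peval raddf_sum; apply: eq_bigr => i _; rewrite /= linearZ /=; congr (_ *: _).
by elim: (nat_of_ord i) => [|n IH] //; rewrite !iterS fq IH.
Qed.

Lemma coext_map (R R' : calgType k) (Q : {linear R -> R}) (Q' : {linear R' -> R'})
    (phi : alg_hom R R') (phiQ : forall x, phi (Q x) = Q' (phi x)) f :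
  hur_map lam phi (canon_coext lam w Q f) = canon_coext lam w Q' (hur_map lam phi f).
Proof.
have H p g : hur_map lam phi (peval p (hur_der lam R) g) =
    peval p (hur_der lam R') (hur_map lam phi g) by exact: morph_peval.
apply: funext => n; rewrite -[LHS]/(phi (coext_at w Q n f)) -[RHS]/(coext_at w Q' n _).
elim: n f => [|n IH] f; first by rewrite /= phiQ.
by rewrite !coext_atS linearD /= IH -!H.
Qed.

Definition G_ob (X : OA) : ODA :=
  @Op2Alg k oda_prop (hurwitz lam (oa_car X)) (hur_der lam (oa_car X))
    (canon_coext lam w (oa_op X)) (conj (hur_der_diff lam _) (coext_of_type w (oa_op X))).

Definition G_fun : functor OA ODA.
Proof.
unshelve refine (@Functor OA ODA G_ob _ _ _).
- move=> X Y f; refine (@Op2Hom k _ _ _ _ _ _ (hur_map lam f) _ _).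
  + by [].
  + exact: (coext_map (op_morP f)).
- by move=> X; apply: op2_hom_ext; apply: alg_hom_ext.
- by move=> X Y Z g f; apply: op2_hom_ext; apply: alg_hom_ext.
Defined.

Definition F_ob (X : OA0) : ORB :=
  @Op2Alg k orb_prop (Sh lam (oa_car X)) (canon_ext lam w (oa_op X))
    (sh_P lam (oa_car X))
    (And3 (@ext1 k lam w _ _ (oa_opP X)) (@sh_P_rb k lam _) (@ext_of_type k lam w _ _ (oa_opP X))).

Lemma sh_map_id (A : calgType k) : sh_map lam (alg_id A) = alg_id (Sh lam A).
Proof.
apply: alg_hom_ext; apply: sh_lin_ext => [||a s].
- exact: (alg_linear (sh_map lam (alg_id A))).
- by [].
by rewrite [LHS]sh_map_fun_tens map_id.
Qed.

Lemma sh_map_comp (A B D : calgType k) (g : alg_hom B D) (f : alg_hom A B) :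
  sh_map lam (alg_comp g f) = alg_comp (sh_map lam g) (sh_map lam f).
Proof.
apply: alg_hom_ext; apply: sh_lin_ext => [||a s].
- exact: (alg_linear (sh_map lam (alg_comp g f))).
- exact: (alg_linear (alg_comp (sh_map lam g) (sh_map lam f))).
by rewrite [LHS]sh_map_fun_tens /= !sh_map_fun_tens map_comp.
Qed.

Lemma sh_map_P (A B : calgType k) (f : alg_hom A B) u :
  sh_map lam f (sh_P lam A u) = sh_P lam B (sh_map lam f u).
Proof. by rewrite [LHS]sh_map_fun_tcons alg_hom1. Qed.

Definition F_fun : functor OA0 ORB.
Proof.
unshelve refine (@Functor OA0 ORB F_ob _ _ _).
- move=> X Y f; refine (@Op2Hom k _ _ _ _ _ _ (sh_map lam f) _ _).
  + exact: (ext_map w (op_morP f)).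
  + exact: sh_map_P.
- by move=> X; apply: op2_hom_ext; exact: sh_map_id.
- by move=> X Y Z g f; apply: op2_hom_ext; exact: sh_map_comp.
Defined.

End TheCategories.

Section TheComonadAndMonad.
Variables (k : comPzRingType) (lam : k).

Definition hur_functor : functor (ALG k) (ALG k).
Proof.
by refine (@Functor (ALG k) (ALG k) (fun A => hurwitz lam A)
  (fun A B f => hur_map lam f) _ _) => *; apply: alg_hom_ext.
Defined.

Lemma iter_shift (A : calgType k) n (f : hurwitz lam A) m :
  iter n (hur_der lam A) f m = f (n + m)%N.
Proof.
elim: n f m => [|n IH] f m //; rewrite iterSr IH.
by rewrite -[LHS]/(f (n + m).+1) addSn.
Qed.

Definition hur_counit : nat_trans hur_functor (id_functor (ALG k)).
Proof.
refine (@NatTrans _ _ hur_functor (id_functor (ALG k)) (hur_head lam) _).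
by move=> A B f; apply: alg_hom_ext.
Defined.

Definition hur_comult : nat_trans hur_functor (hur_functor \F hur_functor).
Proof.
refine (@NatTrans _ _ hur_functor (hur_functor \F hur_functor)
  (fun A => theta (hur_der_diff lam A)) _).
move=> A B f; apply: alg_hom_ext => u; apply: funext => n; apply: funext => m.
rewrite -[LHS]/(iter n (hur_der lam B) (hur_map lam f u) m) iter_shift.
by rewrite -[RHS]/(f (iter n (hur_der lam A) u m)) iter_shift.
Defined.

Definition hur_comonad : comonad (ALG k).
Proof.
refine (@Comonad _ hur_functor hur_counit hur_comult _ _ _).
- by move=> A; apply: alg_hom_ext.
- move=> A; apply: alg_hom_ext => u; apply: funext => n.
  by rewrite -[LHS]/(iter n (hur_der lam A) u 0%N) iter_shift addn0.
- move=> A; apply: alg_hom_ext => u; apply: funext => n; apply: funext => m.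
  rewrite -[RHS]/(iter m (hur_der lam A) (iter n (hur_der lam A) u)).
  rewrite -[LHS]/(iter n (hur_der lam (hurwitz lam A)) (theta (hur_der_diff lam A) u) m).
  rewrite iter_shift -[LHS]/(iter (n + m) (hur_der lam A) u).
  by rewrite addnC iterD.
Defined.

Definition sh_functor : functor (ALG k) (ALG k) :=
  @Functor (ALG k) (ALG k) (fun A => Sh lam A) (fun A B f => sh_map lam f)
    (@sh_map_id k lam) (@sh_map_comp k lam).

Lemma sh_ev_natural (R R' : calgType k) (P : {linear R -> R})
    (P' : {linear R' -> R'}) (rbP : is_rb lam P) (rbP' : is_rb lam P')
    (f : alg_hom R R') :
  (forall x, f (P x) = P' (f x)) ->
  alg_comp (sh_ev rbP') (sh_map lam f) = alg_comp f (sh_ev rbP).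
Proof.
move=> fP; apply: alg_hom_ext; apply: sh_lin_ext => [||a s].
- exact: (alg_linear (alg_comp (sh_ev rbP') (sh_map lam f))).
- exact: (alg_linear (alg_comp f (sh_ev rbP))).
rewrite /= sh_map_fun_tens !sh_ev_fun_tens.
by elim: s a => [|b s IH] a //=; rewrite IH alg_homM fP.
Qed.

Definition sh_unit : nat_trans (id_functor (ALG k)) sh_functor.
Proof.
refine (@NatTrans _ _ (id_functor (ALG k)) sh_functor (sh_incl lam) _).
by move=> A B f; apply: alg_hom_ext => a; rewrite [RHS]sh_map_fun_tens.
Defined.

Definition sh_mult : nat_trans (sh_functor \F sh_functor) sh_functor.
Proof.
refine (@NatTrans _ _ (sh_functor \F sh_functor) sh_functor
  (fun A => sh_ev (@sh_P_rb k lam A)) _).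
by move=> A B f; apply: sh_ev_natural; exact: sh_map_P.
Defined.

Definition sh_monad : monad (ALG k).
Proof.
refine (@Monad _ sh_functor sh_unit sh_mult _ _ _).
- by move=> A; apply: alg_hom_ext => u; rewrite [LHS]sh_ev_fun_tens.
- move=> A; apply: alg_hom_ext; apply: sh_lin_ext => [||a s].
  + exact: (alg_linear (alg_comp (sh_mult A) (sh_map lam (sh_incl lam A)))).
  + by [].
  rewrite /= sh_map_fun_tens sh_ev_fun_tens.
  elim: s a => [|b s IH] a //=; rewrite IH.
  by rewrite tcons_tens sh_mulE sh_mul_in mulr1.
- move=> A; symmetry; apply: sh_ev_natural => u.
  by rewrite [LHS]sh_ev_fun_tcons mul1r.
Defined.

(* The isomorphism between DIF and the coalgebras of the Hurwitz comonad:
   (R, d) |-> <R, u |-> (d^n u)_n>. *)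
Definition DIF_coalg_ob (X : DIF lam) : coalg_cat hur_comonad.
Proof.
refine (@Coalgebra _ hur_comonad (oa_car X : ALG k) (theta (oa_opP X)) _ _).
- by apply: alg_hom_ext.
- apply: alg_hom_ext => u; apply: funext => n; apply: funext => m.
  rewrite -[LHS]/(iter n (hur_der lam _) (theta (oa_opP X) u) m) iter_shift.
  rewrite -[RHS]/(iter m (oa_op X) (iter n (oa_op X) u)).
  by rewrite -[LHS]/(iter (n + m) (oa_op X) u) addnC iterD.
Defined.

Definition DIF_coalg : functor (DIF lam) (coalg_cat hur_comonad).
Proof.
unshelve refine (@Functor (DIF lam) (coalg_cat hur_comonad) DIF_coalg_ob _ _ _).
- move=> X Y f.
  refine (@CoalgHom _ hur_comonad (DIF_coalg_ob X) (DIF_coalg_ob Y) (op_mor f) _).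
  apply: alg_hom_ext => u; apply: funext => n /=.
  by elim: n => [|n IH] //=; rewrite op_morP IH.
- by move=> X; apply: coalg_hom_ext.
- by move=> X Y Z g f; apply: coalg_hom_ext.
Defined.

End TheComonadAndMonad.

(* Main.v *)
From HB Require Import structures.
Require Import Defs.
From mathcomp Require Import all_boot all_algebra boolp.

Set Implicit Arguments.
Unset Strict Implicit.
Unset Printing Implicit Defensive.

Import GRing.Theory.
Local Open Scope ring_scope.

(* The canonical (co)extensions are universal among operators of type omega: a
   hom out of Sh(R) carrying P_R to Q, with omega(e, Q) = 0, intertwines the
   canonical extension of d with e as soon as it does so on R, and dually for
   maps into R^N. Given (b), composing the coalgebra map of (Sh(R^N), D) with
   the evaluation Sh(R^N) -> R gives an algebra hom Sh(R^N) -> R^N carrying the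
   Rota-Baxter operator P to the canonical coextension, hence (a); the map
   Sh(R) -> Sh(R)^N obtained from the freeness of Sh(R) gives the converse.
   Any lifting as in (e) must be the canonical one: surjectivity of H applied
   to a cofree coalgebra shows that its operator has type omega over the shift.
   The same holds for (f) and (g) with free algebras; conversely (b) provides
   the distributive law beta_A(u)_n = Sh(eps_A)(D^n u). *)

(** * Canonical extensions and coextensions *)

Section Comparison.
Variables (k : comPzRingType) (lam : k) (w : omega k).

(** The invariant set [K] lets commutation be known only on one step of the filtration of Sh(R), as
    in an induction on degree. *)
Lemma peval_morph (M N : lmodType k) (f : {linear M -> N}) (K : M -> Prop)
    (q : M -> M) (q' : N -> N) p u :
  (forall v, K v -> K (q v)) -> (forall v, K v -> f (q v) = q' (f v)) -> K u ->
  f (peval p q u) = peval p q' (f u).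
Proof.
move=> Kq fq Ku; rewrite /peval linear_sum; apply: eq_bigr => i _.
rewrite linearZ /=; congr (_ *: _).
have [] // : K (iter i q u) /\ f (iter i q u) = iter i q' (f u).
elim: (nat_of_ord i) => [|n [Kn IH]] //; rewrite !iterS.
by split; [exact: Kq | rewrite fq ?IH].
Qed.

Lemma iter_morph (X Y : Type) (f : X -> Y) (q : X -> X) (q' : Y -> Y) n u :
  (forall v, f (q v) = q' (f v)) -> f (iter n q u) = iter n q' (f u).
Proof. by move=> fq; elim: n => [|n IH] //; rewrite !iterS fq IH. Qed.

(** Induction on the index, with [u] varying: entry n+1 of g(Qu) is entry n of g(e(Qu)), and
    expanding eQ by its type gives the recursion that defines the coextension. *)
Lemma coext_morph (S : lmodType k) (R : calgType k) (e Q : {linear S -> S})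
    (P : {linear R -> R}) (g : {linear S -> hurwitz lam R}) :
  of_type w e Q -> (forall u, g (e u) = hur_der lam R (g u)) ->
  (forall u, g (Q u) 0%N = P (g u 0%N)) ->
  forall u, g (Q u) = canon_coext lam w P (g u).
Proof.
move=> eQ ge gQ u; apply: funext => n; elim: n u => [|n IH] u; first exact: gQ.
rewrite -[LHS]/(hur_der lam R (g (Q u)) n) -ge eQ linearD [LHS]seqmodD IH.
rewrite -[RHS]/(_ + coext_at w P n _).
have gp p v : g (peval p e v) = peval p (hur_der lam R) (g v).
  exact: (peval_morph (K := fun=> True)).
by rewrite !gp.
Qed.

(** Every longer word thus becomes a product of its head with a value of P_R, so inductions on words
    only use compatibility with R and P_R. *)
Lemma tconsE (R : calgType k) (a : R) (u : Sh lam R) :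
  tcons a u = sh_incl lam R a * sh_P lam R u.
Proof. by rewrite sh_mulE sh_mul_in_tcons mulr1. Qed.

(** Induction on degree: expanding e(f(a) Q(f(u))) by the Leibniz rule and then eQ by its type gives
    the image of the formula that defines the extension on a (x) u. *)
Lemma ext_morph (R B : calgType k) (d : {linear R -> R}) (e Q : {linear B -> B})
    (f : alg_hom (Sh lam R) B) :
  is_diff lam e -> of_type w e Q ->
  (forall a, f (sh_incl lam R (d a)) = e (f (sh_incl lam R a))) ->
  (forall u, f (sh_P lam R u) = Q (f u)) ->
  forall u, f (canon_ext lam w d u) = e (f u).
Proof.
move=> [eM _] eQ fd fP u; have [d1 d2 d3] := ext_is_ext lam w d.
have lL := lin_comp (alg_linear f) (linearP (canon_ext lam w d)).
have lR := lin_comp (linearP e) (alg_linear f).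
have [n un] := fil_ex u; elim: n u un => [|n IH] u un; apply: (fil_eq lL lR _ un) => //.
move=> a [|b s] sn; first by rewrite d1.
have tn : sh_fil n (tens b s) by exact: fil_tens.
(* [d2] keeps the iterates of the tail in degree at most n, where the induction hypothesis
   applies. *)
have fp p : f (peval p (canon_ext lam w d) (tens b s)) = peval p e (f (tens b s)).
  by apply: (@peval_morph (Sh lam R) B f (sh_fil n)) => // v vn; exact: d2.
have fa : f (sh_incl lam R (a + lam *: d a)) =
    lam *: e (f (sh_incl lam R a)) + f (sh_incl lam R a).
  by rewrite addrC (alg_linear (sh_incl lam R)) (alg_linear f) fd.
have fD x y : f (x + y) = f x + f y by exact: linearD.
rewrite -tcons_tens d3 !tconsE fD !alg_homM fD fa fd !fP !fp eM eQ.
by rewrite mulrDl -calg_scalerAl [X in _ + X]addrC addrA.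
Qed.

Lemma ext_incl (R : calgType k) (d : {linear R -> R}) a :
  canon_ext lam w d (sh_incl lam R a) = sh_incl lam R (d a).
Proof. by have [] := ext_is_ext lam w d. Qed.

(** The identity of Sh(R) is put into [ext_morph]: the Leibniz rule and the type, which a derivation
    from an abstract lifting comes with, replace the conditions of [is_ext]. *)
Lemma ext_eq (R : calgType k) (d : {linear R -> R}) (e : {linear Sh lam R -> Sh lam R}) :
  is_diff lam e -> of_type w e (sh_P lam R) ->
  (forall a, e (sh_incl lam R a) = sh_incl lam R (d a)) -> canon_ext lam w d = e.
Proof.
move=> eD eP ed; apply: linear_ext.
by apply: (@ext_morph R (Sh lam R) d e (sh_P lam R) (alg_id _)) => // a; rewrite /= ed.
Qed.

Lemma coext_eq (R : calgType k) (P : {linear R -> R})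
    (Q : {linear hurwitz lam R -> hurwitz lam R}) :
  is_coext P Q -> of_type w (hur_der lam R) Q -> canon_coext lam w P = Q.
Proof. by move=> Q0 Qw; rewrite (coext_unique Q0 Qw). Qed.

Lemma sh_ev_P (R : calgType k) (P : {linear R -> R}) (rbP : is_rb lam P) u :
  sh_ev rbP (sh_P lam R u) = P (sh_ev rbP u).
Proof. by rewrite [LHS]sh_ev_fun_tcons mul1r. Qed.

Lemma sh_ev_incl (R : calgType k) (P : {linear R -> R}) (rbP : is_rb lam P) a :
  sh_ev rbP (sh_incl lam R a) = a.
Proof. exact: sh_ev_fun_tens. Qed.

Lemma sh_map_incl (A B : calgType k) (f : alg_hom A B) a :
  sh_map lam f (sh_incl lam A a) = sh_incl lam B (f a).
Proof. exact: sh_map_fun_tens. Qed.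

Lemma sh_ev_ext (R : calgType k) (d P : {linear R -> R}) (rbP : is_rb lam P) :
  is_diff lam d -> of_type w d P ->
  forall u, sh_ev rbP (canon_ext lam w d u) = d (sh_ev rbP u).
Proof.
move=> dD dP; apply: (ext_morph dD dP) => [a|u]; first by rewrite !sh_ev_incl.
exact: sh_ev_P.
Qed.

Lemma theta_der (R : calgType k) (d : {linear R -> R}) (dD : is_diff lam d) u :
  theta dD (d u) = hur_der lam R (theta dD u).
Proof. by apply: funext => n; rewrite -[LHS]/(iter n d (d u)) -iterSr. Qed.

Lemma theta_coext (R : calgType k) (d P : {linear R -> R}) (dD : is_diff lam d) :
  of_type w d P -> forall u, theta dD (P u) = canon_coext lam w P (theta dD u).
Proof. by move=> dP; apply: (coext_morph (e := d)) => // u; exact: theta_der. Qed.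

(* Index n of g is ev_P o Sh(eps) o D^n, with D the canonical extension of the
   derivation of A = R^N; g fixes A and turns P_A into the coextension of P. *)
Lemma coext_rb_of_ext_diff :
  (forall (R : calgType k) (d : {linear R -> R}),
     is_diff lam d -> is_diff lam (canon_ext lam w d)) ->
  forall (R : calgType k) (P : {linear R -> R}),
    is_rb lam P -> is_rb lam (canon_coext lam w P).
Proof.
move=> extD R P rbP.
have D := hur_der_diff lam R; have hD := extD _ _ D.
pose h := alg_comp (sh_ev rbP) (sh_map lam (hur_head lam R)).
pose g := alg_comp (hur_map lam h) (theta hD).
have gin a : g (sh_incl lam (hurwitz lam R) a) = a.
  apply: funext => n; rewrite -[LHS]/(h (iter n _ _)).
  rewrite -(iter_morph (f := sh_incl lam (hurwitz lam R)) (q := hur_der lam R)); last first.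
    by move=> v; rewrite ext_incl.
  rewrite -[LHS]/(sh_ev rbP (sh_map lam _ _)) sh_map_incl sh_ev_incl.
  by rewrite -[LHS]/(iter _ _ _ 0%N) iter_shift addn0.
have gP u : g (sh_P lam (hurwitz lam R) u) = canon_coext lam w P (g u).
  move: u; apply: (@coext_morph (Sh lam (hurwitz lam R)) R (canon_ext lam w (hur_der lam R))
    (sh_P lam (hurwitz lam R)) P g).
  - exact: ext_of_type D.2.
  - by move=> u; rewrite -[LHS]/(hur_map lam h (theta hD _)) theta_der.
  - move=> u; rewrite -[LHS]/(sh_ev rbP (sh_map lam _ (sh_P lam (hurwitz lam R) u))).
    by rewrite sh_map_P sh_ev_P.
have gD u v : g (u + v) = g u + g v by exact: linearD.
have gZ c u : g (c *: u) = c *: g u by exact: linearZ.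
(* Elements of R^N are images under g of words of length one, so the identity for P_A pushes forward
   along g. *)
move=> x y; rewrite -[x]gin -[y]gin.
by rewrite -!gP -!alg_homM -!gP sh_P_rb !gD gZ [in RHS]alg_homM.
Qed.

(* g is the Rota-Baxter hom extending a |-> (d^n a)_n; its index-one component
   is the canonical extension of d, and Leibniz is multiplicativity of g there. *)
Lemma ext_diff_of_coext_rb :
  (forall (R : calgType k) (P : {linear R -> R}),
     is_rb lam P -> is_rb lam (canon_coext lam w P)) ->
  forall (R : calgType k) (d : {linear R -> R}),
    is_diff lam d -> is_diff lam (canon_ext lam w d).
Proof.
move=> coextP R d dD.
have hP := coextP _ _ (@sh_P_rb k lam R).
pose i := alg_comp (hur_map lam (sh_incl lam R)) (theta dD).
pose g := alg_comp (sh_ev hP) (sh_map lam i).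
have gin a : g (sh_incl lam R a) = i a.
  by rewrite -[LHS]/(sh_ev hP (sh_map lam i _)) sh_map_incl sh_ev_incl.
have gP u : g (sh_P lam R u) = canon_coext lam w (sh_P lam R) (g u).
  by rewrite -[LHS]/(sh_ev hP (sh_map lam i _)) sh_map_P sh_ev_P.
have gd u : g (canon_ext lam w d u) = hur_der lam (Sh lam R) (g u).
  move: u; apply: (ext_morph (hur_der_diff lam (Sh lam R)) (coext_of_type w (sh_P lam R))) => //.
  by move=> a; rewrite !gin -[LHS]/(hur_map lam _ (theta dD (d a))) theta_der.
(* The head of g fixes R and commutes with P_R, hence is the identity of Sh(R). *)
have g0 u : g u 0%N = u.
  move: u; apply: sh_lin_ext => [||a s].
  - exact: (alg_linear (alg_comp (hur_head lam (Sh lam R)) g)).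
  - by [].
  elim: s a => [|b s IH] a; first by rewrite [tens a [::]]/(sh_incl lam R a) gin.
  rewrite -tcons_tens tconsE alg_homM hur_mulE hur_mul0 gin gP.
  by rewrite -[X in _ * X]/(sh_P lam R (g _ 0%N)) IH.
have dE u : canon_ext lam w d u = g u 1%N by rewrite -[LHS]g0 gd.
split=> [x y|]; last exact: ext1 dD.2.
by rewrite !dE alg_homM hur_mulE hur_mulS !hur_mul0 !g0.
Qed.

End Comparison.

(** * Arrows, faithful functors and isomorphisms of categories *)

(** The hypothesis equates dependent triples; transport along its endpoint equations, whose proofs
    are irrelevant, recovers the equality of morphisms. *)
Lemma arrow_inj (C : category) (x y : C) (f g : mor x y) : Arrow f = Arrow g -> f = g.
Proof.
pose cast (a : arrow C) (ex : src a = x) (ey : tgt a = y) : mor x y :=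
  eq_rect _ (fun z => mor x z) (eq_rect _ (fun z => mor z (tgt a)) (arr a) x ex) y ey.
have castE a ex ey : Arrow g = a -> cast a ex ey = g.
  move=> E; move: ex ey; rewrite -E => ex ey.
  by rewrite (Prop_irrelevance ex erefl) (Prop_irrelevance ey erefl).
by move=> /esym/(castE (Arrow f) erefl erefl).
Qed.

Section Arrows.
Variables C D : category.

Definition faithful (U : functor C D) :=
  forall (x y : C) (f g : mor x y), fmap U f = fmap U g -> f = g.

(** [U] may identify distinct objects, so the endpoints are equated in [C] separately. *)
Lemma faithful_arrow (U : functor C D) (x y x' y' : C) (f : mor x y)
    (f' : mor x' y') :
  faithful U -> x = x' -> y = y' -> Arrow (fmap U f) = Arrow (fmap U f') ->
  Arrow f = Arrow f'.
Proof. by move=> Uf ex ey; subst x' y' => /arrow_inj/Uf ->. Qed.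

(** Serves to move the unit or counit of an abstract lifting onto an object that equals its endpoint
    without being convertible to it. *)
Lemma mor_transport (U : functor C D) (x y x' y' : C) (f : mor x y) :
  x = x' -> y = y' ->
  exists f' : mor x' y', Arrow (fmap U f') = Arrow (fmap U f).
Proof. by move=> <- <-; exists f. Qed.

Lemma coalgebra_eq (U : functor C D) (W : comonad C) (X Y : coalgebra W) :
  faithful U -> coalg_car X = coalg_car Y ->
  Arrow (fmap U (coalg_map X)) = Arrow (fmap U (coalg_map Y)) -> X = Y.
Proof.
case: X Y => [x m p q] [y n p' q'] /= Uf xy; subst y => /arrow_inj/Uf mn; subst n.
by rewrite (Prop_irrelevance p p') (Prop_irrelevance q q').
Qed.

Lemma algebra_eq (U : functor C D) (T : monad C) (X Y : algebra T) :
  faithful U -> alg_car X = alg_car Y ->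
  Arrow (fmap U (alg_map X)) = Arrow (fmap U (alg_map Y)) -> X = Y.
Proof.
case: X Y => [x m p q] [y n p' q'] /= Uf xy; subst y => /arrow_inj/Uf mn; subst n.
by rewrite (Prop_irrelevance p p') (Prop_irrelevance q q').
Qed.

Definition cofree_coalg (W : comonad C) (X : C) : coalg_cat W :=
  Coalgebra (comonad_counitl W X) (comonad_coassoc W X).

Definition free_alg (T : monad C) (X : C) : alg_cat T :=
  Algebra (monad_unitl T X) (monad_assoc T X).

Lemma cat_iso_surj (F : functor C D) (y : D) : is_cat_iso F -> exists x, F x = y.
Proof. by case=> G [_ [FG _]]; exists (G y); exact: FG. Qed.

End Arrows.

Lemma coalg_forget_faithful (C : category) (W : comonad C) : faithful (coalg_forget W).
Proof. by move=> X Y f g; exact: coalg_hom_ext. Qed.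

Lemma alg_forget_faithful (C : category) (T : monad C) : faithful (alg_forget T).
Proof. by move=> X Y f g; exact: algebra_hom_ext. Qed.

(** * The T-algebra underlying an algebra over a lifted monad *)

Section LiftedAlgebra.
Variables (C : category) (T : monad C) (W : comonad C) (b : mixed_law T W).
Variables X Y : alg_cat (lift_monad b).

Lemma lift_alg_unit :
  coalg_mor (alg_map X) \c munit T (coalg_car (alg_car X)) = idm _.
Proof. by have /(f_equal (@coalg_mor _ _ _ _)) := alg_unit X. Qed.

Lemma lift_alg_assoc :
  coalg_mor (alg_map X) \c mmult T (coalg_car (alg_car X)) =
  coalg_mor (alg_map X) \c fmap T (coalg_mor (alg_map X)).
Proof. by have /(f_equal (@coalg_mor _ _ _ _)) := alg_assoc X. Qed.

Lemma lift_alg_mor (f : mor X Y) :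
  coalg_mor (alg_mor f) \c coalg_mor (alg_map X) =
  coalg_mor (alg_map Y) \c fmap T (coalg_mor (alg_mor f)).
Proof. by have /(f_equal (@coalg_mor _ _ _ _)) := alg_morP f. Qed.

End LiftedAlgebra.

Lemma comp_faithful (C D E : category) (U : functor C D) (V : functor D E) :
  faithful U -> faithful V -> faithful (V \F U).
Proof. by move=> Uf Vf x y f g /Vf/Uf. Qed.

(** Faithfulness moves the equations between morphisms to [B], over which both functors lie;
    bijectivity on objects does the rest. *)
Lemma cat_iso_over (B C D : category) (U : functor C B) (V : functor D B)
    (F : functor C D) (G : functor D C) :
  faithful U -> faithful V ->
  (forall x, G (F x) = x) -> (forall y, F (G y) = y) ->
  (forall x y (f : mor x y), Arrow (fmap V (fmap F f)) = Arrow (fmap U f)) ->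
  (forall x y (g : mor x y), Arrow (fmap U (fmap G g)) = Arrow (fmap V g)) ->
  is_cat_iso F.
Proof.
move=> Uf Vf GF FG VF UG; exists G; split; split => // x y f.
- by apply: (faithful_arrow Uf (GF x) (GF y)); rewrite UG VF.
- by apply: (faithful_arrow Vf (FG x) (FG y)); rewrite VF UG.
Qed.

Section Operated.
Variable k : comPzRingType.

Lemma op_forget_faithful (K : op_prop k) : faithful (op_forget K).
Proof. by move=> X Y f g; exact: op_hom_ext. Qed.

Definition op2_forget (K : op2_prop k) : functor (op2_cat K) (ALG k) :=
  @Functor (op2_cat K) (ALG k) (@o2_car k K) (fun _ _ f => op2_mor f)
    (fun=> erefl) (fun _ _ _ _ _ => erefl).

Lemma op2_forget_faithful (K : op2_prop k) : faithful (op2_forget K).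
Proof. by move=> X Y f g; exact: op2_hom_ext. Qed.

Lemma alg_hom_fun (A B : calgType k) (f g : alg_hom A B) : f = g -> f =1 g.
Proof. by move=> ->. Qed.

Lemma op_hom_fun (A B : calgType k) (q : A -> A) (q' : B -> B) (f g : op_hom q q') :
  f = g -> op_mor f =1 op_mor g.
Proof. by move=> ->. Qed.

Lemma op_alg_eq (K : op_prop k) (X : op_alg K) (p : K _ (oa_op X)) : OpAlg p = X.
Proof. by case: X p => R q p p'; rewrite (Prop_irrelevance p p'). Qed.

Lemma op2_alg_eq (K : op2_prop k) (X : op2_alg K) q p (H : K (o2_car X) q p) :
  q = o2_op1 X -> p = o2_op2 X -> Op2Alg H = X.
Proof.
by case: X q p H => R q p H q' p' H' /= eq ep; subst q' p'; rewrite (Prop_irrelevance H H').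
Qed.

Section Lift.
Variables (C : category) (K L : op2_prop k) (F : functor C (op2_cat L)).
Hypothesis KF : forall X, K (o2_op1 (F X)) (o2_op2 (F X)).

(** Morphisms of [op2_cat] do not see the predicate, so [F] keeps its action on them. *)
Definition op2_lift : functor C (op2_cat K) :=
  @Functor C (op2_cat K) (fun X => Op2Alg (KF X)) (fun _ _ f => fmap F f)
    (fmap_id F) (fmap_comp F).

Lemma op2_liftK (KL : forall (R : calgType k) (q p : {linear R -> R}), K q p -> L q p) :
  functor_eq (op2_incl (@KL) \F op2_lift) F.
Proof.
have obE X : (op2_incl (@KL) \F op2_lift) X = F X by exact: op2_alg_eq.
by split=> // X Y f; apply: (faithful_arrow (@op2_forget_faithful L)).
Qed.

End Lift.
End Operated.

(** * Differential and Rota-Baxter operators from (co)algebras *)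

Section Canonical.
Variables (k : comPzRingType) (lam : k).

(** * Differential operators from coalgebras of the Hurwitz comonad *)

Section HurCoalgebra.
Variables (R : calgType k) (m : alg_hom R (hurwitz lam R)).

Let der_lin : linear (fun u => m u 1%N).
Proof. by move=> c x y; rewrite (alg_linear m). Qed.

Definition coalg_der : {linear R -> R} :=
  HB.pack (fun u => m u 1%N) (GRing.isLinear.Build k R R _ _ der_lin).

Hypothesis mcounit : forall u, m u 0%N = u.

(** At index one the Hurwitz product is the Leibniz rule of weight lambda. *)
Lemma coalg_der_diff : is_diff lam coalg_der.
Proof.
split=> [x y|]; rewrite -[LHS]/(m _ 1%N); last by rewrite alg_hom1.
by rewrite alg_homM hur_mulE hur_mulS !hur_mul0 !mcounit.
Qed.

Hypothesis mcoassoc : forall u n, iter n (hur_der lam R) (m u) = m (m u n).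

(** Coassociativity gives m(u)_(n+1) = m(m(u)_n)_1, so m(u)_n is the n-th iterate of [coalg_der]. *)
Lemma coalg_theta (dD : is_diff lam coalg_der) : theta dD = m.
Proof.
apply: alg_hom_ext => u; apply: funext => n; elim: n => [|n IH] //.
rewrite -[LHS]/(coalg_der (iter n coalg_der u)).
rewrite -[iter n _ _]/(theta dD u n) IH.
by rewrite -[LHS]/(m (m u n) 1%N) -mcoassoc iter_shift addn1.
Qed.

(** The recursion of the coextension is read at index one, and m carries [coalg_der] to the
    shift. *)
Lemma coalg_der_type (w : omega k) (P : {linear R -> R}) :
  (forall u, m (P u) = canon_coext lam w P (m u)) -> of_type w coalg_der P.
Proof.
move=> mP u; rewrite -[LHS]/(m (P u) 1%N) mP.
have mp p : peval p (hur_der lam R) (m u) = m (peval p coalg_der u).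
  by rewrite (morph_peval (q' := hur_der lam R)) // => v; rewrite -(coalg_theta coalg_der_diff) theta_der.
by rewrite -[LHS]/(peval (om_phi w) (hur_der lam R) (m u) 0%N +
  P (peval (om_psi w) (hur_der lam R) (m u) 0%N)) !mp !mcounit.
Qed.

End HurCoalgebra.

(** * Rota-Baxter operators from algebras over the shuffle monad *)

Section ShAlgebra.
Variables (R : calgType k) (a : alg_hom (Sh lam R) R).

Let rb_lin : linear (fun u => a (sh_P lam R (sh_incl lam R u))).
Proof. by move=> c x y; rewrite (alg_linear (sh_incl lam R)) linearP (alg_linear a). Qed.

Definition alg_rb : {linear R -> R} :=
  HB.pack (fun u => a (sh_P lam R (sh_incl lam R u)))
    (GRing.isLinear.Build k R R _ _ rb_lin).

Hypothesis aunit : forall u, a (sh_incl lam R u) = u.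
Hypothesis aassoc : forall u,
  a (sh_ev (@sh_P_rb k lam R) u) = a (sh_map lam a u).

(** Associativity at the element P(eta(u)) of Sh(Sh(R)): the multiplication sends it to P_R(u), and
    Sh(a) sends it to P_R(eta(a(u))). *)
Lemma alg_rb_P u : a (sh_P lam R u) = alg_rb (a u).
Proof.
rewrite -{1}[u](sh_ev_incl (@sh_P_rb k lam R)) -sh_ev_P aassoc.
by rewrite sh_map_P sh_map_incl.
Qed.

Lemma alg_rb_rb : is_rb lam alg_rb.
Proof.
have aD u v : a (u + v) = a u + a v by exact: linearD.
have aZ c u : a (c *: u) = c *: a u by exact: linearZ.
move=> x y; rewrite -[X in X * _]/(a _) -[X in _ * X]/(a _) -alg_homM sh_P_rb.
by rewrite !aD aZ !alg_rb_P !alg_homM !alg_rb_P !aunit.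
Qed.

(** Both sides are multiplicative, fix R and carry P_R to [alg_rb]; induction on words concludes. *)
Lemma alg_ev (rbP : is_rb lam alg_rb) : sh_ev rbP = a.
Proof.
apply: alg_hom_ext; apply: sh_lin_ext => [||b s].
- exact: (alg_linear (sh_ev rbP)).
- exact: (alg_linear a).
elim: s b => [|c s IH] b; first by rewrite [tens b [::]]/(sh_incl lam R b) sh_ev_incl aunit.
by rewrite -tcons_tens (@tconsE k lam) !alg_homM sh_ev_P IH alg_rb_P sh_ev_incl aunit.
Qed.

(** The homomorphism a is applied to the type relation of the canonical extension at eta(u). *)
Lemma alg_rb_type (w : omega k) (d : {linear R -> R}) : is_diff lam d ->
  (forall u, a (canon_ext lam w d u) = d (a u)) -> of_type w d alg_rb.
Proof.
move=> dD ad u; rewrite -[in LHS]/(a _) -ad (ext_of_type w dD.2).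
have ap p : a (peval p (canon_ext lam w d) (sh_incl lam R u)) = peval p d u.
  by rewrite (morph_peval (q' := d)) // aunit.
by rewrite -[LHS]/(a (_ + _)) linearD /= alg_rb_P !ap.
Qed.

End ShAlgebra.

Lemma coalg_der_theta (R : calgType k) (d : {linear R -> R}) (dD : is_diff lam d) :
  coalg_der (theta dD) = d.
Proof. exact: linear_ext. Qed.

Lemma alg_rb_ev (R : calgType k) (P : {linear R -> R}) (rbP : is_rb lam P) :
  alg_rb (sh_ev rbP) = P.
Proof.
apply: linear_ext => u; rewrite -[LHS]/(sh_ev rbP (sh_P lam R _)).
by rewrite sh_ev_P sh_ev_incl.
Qed.

End Canonical.

(** * Functors, liftings and the mixed distributive law *)

Section Implications.
Variables (k : comPzRingType) (lam : k) (w : omega k).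

Definition coext_rb := forall (R : calgType k) (P : {linear R -> R}),
  is_rb lam P -> is_rb lam (canon_coext lam w P).

Definition ext_diff := forall (R : calgType k) (d : {linear R -> R}),
  is_diff lam d -> is_diff lam (canon_ext lam w d).

Lemma drb_type (R : calgType k) (d P : {linear R -> R}) :
  drb_prop lam w d P -> of_type w d P.
Proof. by case. Qed.

Lemma coext_functor :
  coext_rb <-> exists G : functor (RBA lam) (DRB lam w),
    functor_eq (DRB_ODA lam w \F G) (G_fun lam w \F RBA_OA lam).
Proof.
split=> [coextP|[G [E _]] R P rbP].
  have K (X : RBA lam) : drb_prop lam w (hur_der lam (oa_car X)) (canon_coext lam w (oa_op X)).
    split; [exact: hur_der_diff | exact: coextP (oa_opP X) | exact: coext_of_type].
  exists (op2_lift (F := G_fun lam w \F RBA_OA lam) K); exact: op2_liftK.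
pose X : RBA lam := OpAlg rbP.
(* The equation on objects identifies the second operator of [G X] with the coextension of P. *)
have : is_rb lam (o2_op2 ((DRB_ODA lam w \F G) X)) by exact: drb_rba (o2_opP (G X)).
by rewrite E.
Qed.

Lemma ext_functor :
  ext_diff <-> exists F : functor (DIF lam) (DRB lam w),
    functor_eq (DRB_ORB lam w \F F) (F_fun lam w \F DIF_OA0 lam).
Proof.
split=> [extD|[F [E _]] R d dD].
  have K (X : DIF lam) : drb_prop lam w (canon_ext lam w (oa_op X)) (sh_P lam (oa_car X)).
    split; [exact: extD (oa_opP X) | exact: sh_P_rb | exact: ext_of_type (oa_opP X).2].
  exists (op2_lift (F := F_fun lam w \F DIF_OA0 lam) K); exact: op2_liftK.
pose X : DIF lam := OpAlg dD.
have : is_diff lam (o2_op1 ((DRB_ORB lam w \F F) X)) by exact: drb_dif (o2_opP (F X)).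
by rewrite E.
Qed.

(** The hypotheses say that Z carries the cofree coalgebra on X, with counit u. The structure map
    forces its derivation to be the shift, and u makes its Rota-Baxter operator a coextension, which
    uniqueness identifies with the canonical one. *)
Lemma coext_rb_of_cofree (X : RBA lam) (Z : DRB lam w) (u : mor (DRB_RBA lam w Z) X) :
  Arrow (theta (drb_dif (o2_opP Z)) : @mor (ALG k) _ _) =
    Arrow (theta (hur_der_diff lam (oa_car X)) : @mor (ALG k) _ _) ->
  Arrow (fmap (RBA_ALG lam) u) = Arrow (hur_head lam (oa_car X) : @mor (ALG k) _ _) ->
  is_rb lam (canon_coext lam w (oa_op X)).
Proof.
case: Z u => S d P dP u /= E; have ES : S = hurwitz lam (oa_car X) by exact: (f_equal (@src _) E).
subst S; move/arrow_inj: E => E /arrow_inj/= Eu.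
have Ed : d = hur_der lam (oa_car X).
  by rewrite -(coalg_der_theta (drb_dif dP)) E coalg_der_theta.
subst d; rewrite (@coext_eq k lam w _ _ P); [exact: drb_rba dP | move=> f | by have [] := dP].
by have := op_morP u f; rewrite Eu.
Qed.

(** Dually, Z carries the free algebra on X with unit u: its Rota-Baxter operator is P_R and its
    derivation extends that of X, so [ext_eq] applies. *)
Lemma ext_diff_of_free (X : DIF lam) (Z : DRB lam w) (u : mor X (DRB_DIF lam w Z)) :
  Arrow (sh_ev (drb_rba (o2_opP Z)) : @mor (ALG k) _ _) =
    Arrow (sh_ev (@sh_P_rb k lam (oa_car X)) : @mor (ALG k) _ _) ->
  Arrow (fmap (DIF_ALG lam) u) = Arrow (sh_incl lam (oa_car X) : @mor (ALG k) _ _) ->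
  is_diff lam (canon_ext lam w (oa_op X)).
Proof.
case: Z u => S d P dP u /= E; have ES : S = Sh lam (oa_car X) by exact: (f_equal (@tgt _) E).
subst S; move/arrow_inj: E => E /arrow_inj/= Eu.
have EP : P = sh_P lam (oa_car X).
  by rewrite -(alg_rb_ev (drb_rba dP)) E alg_rb_ev.
subst P; rewrite (@ext_eq k lam w _ _ d); [exact: drb_dif dP | exact: drb_dif dP | by have [] := dP |].
by move=> a; have /= := op_morP u a; rewrite Eu.
Qed.

(** * The lifting of the Hurwitz comonad to Rota-Baxter algebras *)

Section LiftedComonad.
Hypothesis coextP : coext_rb.

Definition rba_hur : functor (RBA lam) (RBA lam).
Proof.
unshelve refine (@Functor (RBA lam) (RBA lam)
  (fun X => OpAlg (coextP (oa_opP X)))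
  (fun X Y f => @OpHom k _ _ _ _ (hur_map lam f) (coext_map w (op_morP f))) _ _).
- by move=> X; apply: op_hom_ext; exact: (fmap_id (hur_functor lam)).
- by move=> X Y Z g f; apply: op_hom_ext; exact: (fmap_comp (hur_functor lam) g f).
Defined.

Definition rba_counit : nat_trans rba_hur (id_functor (RBA lam)).
Proof.
refine (@NatTrans _ _ rba_hur (id_functor (RBA lam))
  (fun X => @OpHom k _ _ (oa_op (rba_hur X)) (oa_op X)
    (hur_head lam (oa_car X)) (fun=> erefl)) _).
by move=> X Y f; apply: op_hom_ext; exact: (naturality (hur_counit lam)).
Defined.

Definition rba_comult : nat_trans rba_hur (rba_hur \F rba_hur).
Proof.
refine (@NatTrans _ _ rba_hur (rba_hur \F rba_hur)
  (fun X => @OpHom k _ _ (oa_op (rba_hur X)) (oa_op (rba_hur (rba_hur X)))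
    (theta (hur_der_diff lam (oa_car X)))
    (theta_coext _ (coext_of_type w (oa_op X)))) _).
by move=> X Y f; apply: op_hom_ext; exact: (naturality (hur_comult lam)).
Defined.

Definition rba_comonad : comonad (RBA lam).
Proof.
refine (@Comonad _ rba_hur rba_counit rba_comult _ _ _).
- by move=> X; apply: op_hom_ext; exact: (comonad_counitl (hur_comonad lam) (oa_car X)).
- by move=> X; apply: op_hom_ext; exact: (comonad_counitr (hur_comonad lam) (oa_car X)).
- by move=> X; apply: op_hom_ext; exact: (comonad_coassoc (hur_comonad lam) (oa_car X)).
Defined.

Lemma rba_comonad_lifts : lifts_comonad (RBA_ALG lam) (hur_comonad lam) rba_comonad.
Proof. by split. Qed.

Definition drb_coalg_ob (X : DRB lam w) : coalg_cat rba_comonad.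
Proof.
refine (@Coalgebra _ rba_comonad (DRB_RBA lam w X)
  (@OpHom k _ _ _ (canon_coext lam w (o2_op2 X)) (theta (drb_dif (o2_opP X)))
     (theta_coext _ (drb_type (o2_opP X)))) _ _).
- by apply: op_hom_ext; apply: alg_hom_ext.
- apply: op_hom_ext.
  exact: (coalg_coassoc (DIF_coalg_ob (DRB_DIF lam w X))).
Defined.

Definition drb_coalg : functor (DRB lam w) (coalg_cat rba_comonad).
Proof.
unshelve refine (@Functor (DRB lam w) (coalg_cat rba_comonad) drb_coalg_ob _ _ _).
- move=> X Y f.
  refine (@CoalgHom _ rba_comonad (drb_coalg_ob X) (drb_coalg_ob Y) (fmap (DRB_RBA lam w) f) _).
  apply: op_hom_ext.
  exact: (coalg_morP (fmap (DIF_coalg lam) (fmap (DRB_DIF lam w) f))).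
- by move=> X; apply: coalg_hom_ext; exact: fmap_id.
- by move=> X Y Z g f; apply: coalg_hom_ext; exact: (fmap_comp (DRB_RBA lam w)).
Defined.

Section DrbOfCoalgebra.
Variable Y : coalg_cat rba_comonad.
Let m : alg_hom _ (hurwitz lam _) := coalg_map Y.

Let mcounit u : m u 0%N = u.
Proof. exact: (op_hom_fun (coalg_counit Y) u). Qed.

Let mcoassoc u n : iter n (hur_der lam _) (m u) = m (m u n).
Proof.
have E := op_hom_fun (coalg_coassoc Y) u.
exact: (f_equal (fun x : hurwitz lam (hurwitz lam _) => x n) E).
Qed.

Definition drb_of_coalg_ob : DRB lam w :=
  @Op2Alg k (drb_prop lam w) _ (coalg_der m) (oa_op (coalg_car Y))
    (And3 (coalg_der_diff mcounit) (oa_opP (coalg_car Y))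
       (coalg_der_type mcounit mcoassoc (op_morP (coalg_map Y)))).

Lemma drb_of_coalgK : drb_coalg drb_of_coalg_ob = Y.
Proof.
apply: (coalgebra_eq (@op_forget_faithful _ _)); first exact: op_alg_eq.
by congr (Arrow (_ : @mor (ALG k) _ _)); exact: coalg_theta.
Qed.

End DrbOfCoalgebra.

Lemma drb_coalgK (X : DRB lam w) : drb_of_coalg_ob (drb_coalg X) = X.
Proof. by apply: op2_alg_eq => //; exact: coalg_der_theta. Qed.

(** This is the square of a coalgebra morphism at index one. *)
Lemma coalg_mor_der (X Y : coalg_cat rba_comonad) (f : mor X Y) u :
  op_mor (coalg_mor f) (coalg_der (coalg_map X) u) =
  coalg_der (coalg_map Y) (op_mor (coalg_mor f) u).
Proof.
have E := op_hom_fun (coalg_morP f) u.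
exact: (f_equal (fun x : hurwitz lam _ => x 1%N) E).
Qed.

Definition drb_of_coalg_mor (X Y : coalg_cat rba_comonad) (f : mor X Y) :
  mor (drb_of_coalg_ob X) (drb_of_coalg_ob Y) :=
  @Op2Hom k _ _ _ _ _ _ (coalg_mor f) (coalg_mor_der f) (op_morP (coalg_mor f)).

Definition drb_of_coalg : functor (coalg_cat rba_comonad) (DRB lam w).
Proof.
refine (@Functor (coalg_cat rba_comonad) (DRB lam w) drb_of_coalg_ob
  drb_of_coalg_mor _ _).
- by move=> X; apply: (@op2_forget_faithful k (drb_prop lam w)).
- by move=> X Y Z g f; apply: (@op2_forget_faithful k (drb_prop lam w)) => /=.
Defined.

Lemma drb_coalg_iso : is_cat_iso drb_coalg.
Proof.
apply: (@cat_iso_over (ALG k) _ _ (op2_forget _)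
  (RBA_ALG lam \F coalg_forget rba_comonad) _ drb_of_coalg) => //.
- exact: op2_forget_faithful.
- exact: comp_faithful (@coalg_forget_faithful _ _) (@op_forget_faithful _ _).
- exact: drb_coalgK.
- exact: drb_of_coalgK.
Qed.

End LiftedComonad.

Lemma coext_comonad :
  coext_rb <-> exists W : comonad (RBA lam),
    lifts_comonad (RBA_ALG lam) (hur_comonad lam) W /\
    exists H : functor (DRB lam w) (coalg_cat W),
      [/\ is_cat_iso H,
          functor_eq (coalg_forget W \F H) (DRB_RBA lam w)
        & forall X : DRB lam w,
            Arrow (fmap (RBA_ALG lam) (coalg_map (H X))) =
            Arrow (theta (drb_dif (o2_opP X)) : @mor (ALG k) _ _)].
Proof.
split=> [coextP|[W [[_ counitW comultW] [H [isoH [HR _] Htheta]]]] R P rbP].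
  exists (rba_comonad coextP); split; first exact: rba_comonad_lifts.
  by exists (drb_coalg coextP); split; [exact: drb_coalg_iso | split |].
pose X : RBA lam := OpAlg rbP.
(* Surjectivity of H puts a structure of type omega on the cofree coalgebra of an arbitrary
   lifting. *)
have [Z HZ] := cat_iso_surj (cofree_coalg W X) isoH.
have EZ : W X = DRB_RBA lam w Z by rewrite -HR [RHS]/(coalg_car (H Z)) HZ.
have [u Eu] := mor_transport (RBA_ALG lam) (wcounit W X) EZ erefl.
apply: (@coext_rb_of_cofree X Z u).
  by rewrite -Htheta HZ comultW.
by rewrite Eu counitW.
Qed.

(** * The lifting of the shuffle monad to differential algebras *)

Section LiftedMonad.
Hypothesis extD : ext_diff.

Definition dif_sh : functor (DIF lam) (DIF lam).
Proof.
unshelve refine (@Functor (DIF lam) (DIF lam)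
  (fun X => OpAlg (extD (oa_opP X)))
  (fun X Y f => @OpHom k _ _ _ _ (sh_map lam f) (ext_map w (op_morP f))) _ _).
- by move=> X; apply: op_hom_ext; exact: (fmap_id (sh_functor lam)).
- by move=> X Y Z g f; apply: op_hom_ext; exact: (fmap_comp (sh_functor lam) g f).
Defined.

Definition dif_unit : nat_trans (id_functor (DIF lam)) dif_sh.
Proof.
refine (@NatTrans _ _ (id_functor (DIF lam)) dif_sh
  (fun X => @OpHom k _ _ (oa_op X) (oa_op (dif_sh X))
    (sh_incl lam (oa_car X)) (fun a => esym (ext_incl lam w (oa_op X) a))) _).
by move=> X Y f; apply: op_hom_ext; exact: (naturality (sh_unit lam)).
Defined.

Definition dif_mult : nat_trans (dif_sh \F dif_sh) dif_sh.
Proof.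
refine (@NatTrans _ _ (dif_sh \F dif_sh) dif_sh
  (fun X => @OpHom k _ _ (oa_op (dif_sh (dif_sh X))) (oa_op (dif_sh X))
    (sh_ev (@sh_P_rb k lam (oa_car X)))
    (sh_ev_ext _ (oa_opP (dif_sh X)) (ext_of_type w (oa_opP X).2))) _).
by move=> X Y f; apply: op_hom_ext; exact: (naturality (sh_mult lam)).
Defined.

Definition dif_monad : monad (DIF lam).
Proof.
refine (@Monad _ dif_sh dif_unit dif_mult _ _ _).
- by move=> X; apply: op_hom_ext; exact: (monad_unitl (sh_monad lam) (oa_car X)).
- by move=> X; apply: op_hom_ext; exact: (monad_unitr (sh_monad lam) (oa_car X)).
- by move=> X; apply: op_hom_ext; exact: (monad_assoc (sh_monad lam) (oa_car X)).
Defined.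

Lemma dif_monad_lifts : lifts_monad (DIF_ALG lam) (sh_monad lam) dif_monad.
Proof. by split. Qed.

Lemma sh_ev_unit (R : calgType k) (P : {linear R -> R}) (rbP : is_rb lam P) :
  alg_comp (sh_ev rbP) (sh_incl lam R) = alg_id R.
Proof. by apply: alg_hom_ext => a; exact: sh_ev_incl. Qed.

(** [sh_ev rbP] is itself a Rota-Baxter homomorphism, and evaluation is natural for those. *)
Lemma sh_ev_assoc (R : calgType k) (P : {linear R -> R}) (rbP : is_rb lam P) :
  alg_comp (sh_ev rbP) (sh_ev (@sh_P_rb k lam R)) =
  alg_comp (sh_ev rbP) (sh_map lam (sh_ev rbP)).
Proof. by symmetry; apply: sh_ev_natural => u; exact: sh_ev_P. Qed.

Definition drb_alg_ob (X : DRB lam w) : alg_cat dif_monad.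
Proof.
refine (@Algebra _ dif_monad (DRB_DIF lam w X)
  (@OpHom k _ _ (canon_ext lam w (o2_op1 X)) _ (sh_ev (drb_rba (o2_opP X)))
     (sh_ev_ext _ (drb_dif (o2_opP X)) (drb_type (o2_opP X)))) _ _).
- by apply: op_hom_ext; exact: sh_ev_unit.
- by apply: op_hom_ext; exact: sh_ev_assoc.
Defined.

Definition drb_alg : functor (DRB lam w) (alg_cat dif_monad).
Proof.
unshelve refine (@Functor (DRB lam w) (alg_cat dif_monad) drb_alg_ob _ _ _).
- move=> X Y f.
  refine (@AlgebraHom _ dif_monad (drb_alg_ob X) (drb_alg_ob Y) (fmap (DRB_DIF lam w) f) _).
  by apply: op_hom_ext; symmetry; apply: sh_ev_natural; exact: op2_morP2 f.
- by move=> X; apply: algebra_hom_ext; exact: fmap_id.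
- by move=> X Y Z g f; apply: algebra_hom_ext; exact: (fmap_comp (DRB_DIF lam w)).
Defined.

Section DrbOfAlgebra.
Variable Y : alg_cat dif_monad.
Let a : alg_hom (Sh lam _) _ := alg_map Y.

Let aunit u : a (sh_incl lam _ u) = u.
Proof. exact: (op_hom_fun (alg_unit Y) u). Qed.

Let aassoc u : a (sh_ev (@sh_P_rb k lam _) u) = a (sh_map lam a u).
Proof. exact: (op_hom_fun (alg_assoc Y) u). Qed.

Definition drb_of_alg_ob : DRB lam w :=
  @Op2Alg k (drb_prop lam w) _ (oa_op (alg_car Y)) (alg_rb a)
    (And3 (oa_opP (alg_car Y)) (alg_rb_rb aunit aassoc)
       (alg_rb_type aunit aassoc (oa_opP (alg_car Y)) (op_morP (alg_map Y)))).

Lemma drb_of_algK : drb_alg drb_of_alg_ob = Y.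
Proof.
apply: (algebra_eq (@op_forget_faithful _ _)); first exact: op_alg_eq.
by congr (Arrow (_ : @mor (ALG k) _ _)); exact: alg_ev.
Qed.

End DrbOfAlgebra.

Lemma drb_algK (X : DRB lam w) : drb_of_alg_ob (drb_alg X) = X.
Proof. by apply: op2_alg_eq => //; exact: alg_rb_ev. Qed.

(** This is the square of an algebra morphism at 1 (x) u. *)
Lemma alg_mor_rb (X Y : alg_cat dif_monad) (f : mor X Y) u :
  op_mor (alg_mor f) (alg_rb (alg_map X) u) =
  alg_rb (alg_map Y) (op_mor (alg_mor f) u).
Proof.
have E := op_hom_fun (alg_morP f) (sh_P lam _ (sh_incl lam _ u)).
apply: etrans E _; rewrite -[LHS]/(op_mor (alg_map Y) (sh_map lam _ _)).
by rewrite sh_map_P sh_map_incl.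
Qed.

Definition drb_of_alg_mor (X Y : alg_cat dif_monad) (f : mor X Y) :
  mor (drb_of_alg_ob X) (drb_of_alg_ob Y) :=
  @Op2Hom k _ _ _ _ _ _ (alg_mor f) (op_morP (alg_mor f)) (alg_mor_rb f).

Definition drb_of_alg : functor (alg_cat dif_monad) (DRB lam w).
Proof.
refine (@Functor (alg_cat dif_monad) (DRB lam w) drb_of_alg_ob drb_of_alg_mor _ _).
- by move=> X; apply: (@op2_forget_faithful k (drb_prop lam w)).
- by move=> X Y Z g f; apply: (@op2_forget_faithful k (drb_prop lam w)) => /=.
Defined.

Lemma drb_alg_iso : is_cat_iso drb_alg.
Proof.
apply: (@cat_iso_over (ALG k) _ _ (op2_forget _)
  (DIF_ALG lam \F alg_forget dif_monad) _ drb_of_alg) => //.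
- exact: op2_forget_faithful.
- exact: comp_faithful (@alg_forget_faithful _ _) (@op_forget_faithful _ _).
- exact: drb_algK.
- exact: drb_of_algK.
Qed.

End LiftedMonad.

Lemma ext_monad :
  ext_diff <-> exists T : monad (DIF lam),
    lifts_monad (DIF_ALG lam) (sh_monad lam) T /\
    exists K : functor (DRB lam w) (alg_cat T),
      [/\ is_cat_iso K,
          functor_eq (alg_forget T \F K) (DRB_DIF lam w)
        & forall X : DRB lam w,
            Arrow (fmap (DIF_ALG lam) (alg_map (K X))) =
            Arrow (sh_ev (drb_rba (o2_opP X)) : @mor (ALG k) _ _)].
Proof.
split=> [extD|[T [[_ unitT multT] [K [isoK [KD _] Kev]]]] R d dD].
  exists (dif_monad extD); split; first exact: dif_monad_lifts.
  by exists (drb_alg extD); split; [exact: drb_alg_iso | split |].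
pose X : DIF lam := OpAlg dD.
have [Z KZ] := cat_iso_surj (free_alg T X) isoK.
have EZ : T X = DRB_DIF lam w Z by rewrite -KD [RHS]/(alg_car (K Z)) KZ.
have [u Eu] := mor_transport (DIF_ALG lam) (munit T X) erefl EZ.
apply: (@ext_diff_of_free X Z u).
  by rewrite -Kev KZ multT.
by rewrite Eu unitT.
Qed.

(** * The mixed distributive law and its algebras *)

Section MixedLaw.
Hypothesis extD : ext_diff.

(** The coalgebra map from (Sh(A^N), D) to the cofree coalgebra on Sh(A) whose head is Sh(eps_A). *)
Definition beta_at (A : calgType k) :
    alg_hom (Sh lam (hurwitz lam A)) (hurwitz lam (Sh lam A)) :=
  alg_comp (hur_map lam (sh_map lam (hur_head lam A)))
    (theta (extD (hur_der_diff lam A))).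

Lemma theta_shE (A B : calgType k) (f : alg_hom A B) (dA : {linear A -> A})
    (dB : {linear B -> B}) (DA : is_diff lam dA) (DB : is_diff lam dB) :
  (forall x, f (dA x) = dB (f x)) ->
  alg_comp (theta DB) f = alg_comp (hur_map lam f) (theta DA).
Proof.
move=> fd; apply: alg_hom_ext => u; apply: funext => n.
by rewrite -[LHS]/(iter n dB (f u)) -[RHS]/(f (iter n dA u)) (iter_morph (q' := dB)).
Qed.

(** As f is differential, Sh(f) commutes with the canonical extensions and moves past their
    iterates. Naturality, [beta_theta] and the multiplication law rest on this. *)
Lemma beta_sh_map (A : calgType k) (R : calgType k) (d : {linear R -> R})
    (dD : is_diff lam d) (f : alg_hom R (hurwitz lam A)) :
  (forall x, f (d x) = hur_der lam A (f x)) ->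
  alg_comp (beta_at A) (sh_map lam f) =
  alg_comp (hur_map lam (sh_map lam (alg_comp (hur_head lam A) f))) (theta (extD dD)).
Proof.
move=> fd; apply: alg_hom_ext => u; apply: funext => n.
rewrite -[LHS]/(sh_map lam (hur_head lam A) (iter n _ (sh_map lam f u))).
rewrite -(iter_morph (f := sh_map lam f) (q := canon_ext lam w d)); last first.
  by move=> v; rewrite (ext_map w fd).
by rewrite sh_map_comp.
Qed.

(** Case f = theta, where eps o theta is the identity. Hence the monad lifted along beta sends (R,
    d) to Sh(R) with the canonical extension of d. *)
Lemma beta_theta (R : calgType k) (d : {linear R -> R}) (dD : is_diff lam d) :
  alg_comp (beta_at R) (sh_map lam (theta dD)) = theta (extD dD).
Proof.
rewrite (beta_sh_map dD); last exact: theta_der.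
rewrite (_ : alg_comp _ _ = alg_id R); last exact: alg_hom_ext.
by rewrite sh_map_id; exact: alg_hom_ext.
Qed.

Lemma beta_der (A : calgType k) u :
  beta_at A (canon_ext lam w (hur_der lam A) u) = hur_der lam _ (beta_at A u).
Proof. by rewrite -[LHS]/(hur_map lam _ (theta _ _)) theta_der. Qed.

Definition beta_nat :
  nat_trans (sh_functor lam \F hur_functor lam) (hur_functor lam \F sh_functor lam).
Proof.
refine (@NatTrans _ _ (sh_functor lam \F hur_functor lam)
  (hur_functor lam \F sh_functor lam) beta_at _) => A B f.
rewrite -[LHS]/(alg_comp (beta_at B) (sh_map lam (hur_map lam f))).
rewrite (beta_sh_map (hur_der_diff lam A)) //.
apply: alg_hom_ext => u; apply: funext => n.
rewrite -[RHS]/(sh_map lam f (sh_map lam (hur_head lam A) _)).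
by rewrite -[RHS]/(alg_comp _ _ _) -sh_map_comp; congr (alg_fun (sh_map lam _) _); exact: alg_hom_ext.
Defined.

Lemma beta_unit (A : calgType k) :
  alg_comp (beta_at A) (sh_incl lam _) = hur_map lam (sh_incl lam A).
Proof.
apply: alg_hom_ext => f; apply: funext => n.
rewrite -[LHS]/(sh_map lam (hur_head lam A) (iter n _ (sh_incl lam _ f))).
rewrite -(iter_morph (f := sh_incl lam _) (q := hur_der lam A)); last first.
  by move=> v; rewrite ext_incl.
by rewrite sh_map_incl -[hur_head _ _ _]/(iter _ _ _ 0%N) iter_shift addn0.
Qed.

(** [beta_theta] turns the last two factors into the coalgebra structure of Sh(A^N); what remains is
    that beta is a differential homomorphism. *)
Lemma beta_comult (A : calgType k) :
  alg_comp (theta (hur_der_diff lam (Sh lam A))) (beta_at A) =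
  alg_comp (hur_map lam (beta_at A))
    (alg_comp (beta_at (hurwitz lam A)) (sh_map lam (theta (hur_der_diff lam A)))).
Proof. by rewrite beta_theta; exact: (theta_shE _ _ (@beta_der A)). Qed.

(** Both the multiplication and beta commute with the derivations, so at index n each side starts
    from the n-th iterate on Sh(Sh(A^N)); naturality of the multiplication at eps finishes. *)
Lemma beta_mult (A : calgType k) :
  alg_comp (beta_at A) (sh_ev (@sh_P_rb k lam (hurwitz lam A))) =
  alg_comp (hur_map lam (sh_ev (@sh_P_rb k lam A)))
    (alg_comp (beta_at (Sh lam A)) (sh_map lam (beta_at A))).
Proof.
have D := hur_der_diff lam A.
have muD := sh_ev_ext (@sh_P_rb k lam _) (extD D) (ext_of_type w D.2).
rewrite (beta_sh_map (extD D) (@beta_der A)).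
have E : alg_comp (hur_head lam (Sh lam A)) (beta_at A) = sh_map lam (hur_head lam A).
  exact: alg_hom_ext.
rewrite {}E; apply: alg_hom_ext => u; apply: funext => n.
rewrite -[LHS]/(sh_map lam (hur_head lam A) (iter n _ (sh_ev (@sh_P_rb k lam _) u))).
rewrite -(iter_morph _ _ muD).
set v := iter n _ u.
have nat := sh_ev_natural (@sh_P_rb k lam _) (@sh_P_rb k lam _) (sh_map_P (hur_head lam A)).
exact: esym (f_equal (fun h : alg_hom _ _ => h v) nat).
Qed.

Definition beta_law : mixed_law (sh_monad lam) (hur_comonad lam).
Proof.
refine (@MixedLaw _ (sh_monad lam) (hur_comonad lam) beta_nat beta_unit _ _ _) => A.
- exact: alg_hom_ext.
- by apply: etrans (beta_comult A) _; exact: alg_hom_ext.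
- by apply: etrans (beta_mult A) _; exact: alg_hom_ext.
Defined.

Definition drb_law_alg_ob (X : DRB lam w) : alg_cat (lift_monad beta_law).
Proof.
unshelve refine (@Algebra _ (lift_monad beta_law) ((DIF_coalg lam \F DRB_DIF lam w) X)
  (@CoalgHom _ (hur_comonad lam)
    (lift_monad beta_law ((DIF_coalg lam \F DRB_DIF lam w) X))
    ((DIF_coalg lam \F DRB_DIF lam w) X) (sh_ev (drb_rba (o2_opP X))) _) _ _).
- apply: (@etrans _ _ (alg_comp (hur_map lam (sh_ev (drb_rba (o2_opP X))))
    (alg_comp (beta_at (o2_car X)) (sh_map lam (theta (drb_dif (o2_opP X))))))).
    exact: alg_hom_ext.
  (* The coalgebra square now says that evaluation commutes with the derivations. *)
  rewrite beta_theta; symmetry; apply: theta_shE.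
  exact: sh_ev_ext (drb_dif (o2_opP X)) (drb_type (o2_opP X)).
- by apply: coalg_hom_ext; exact: sh_ev_unit.
- by apply: coalg_hom_ext; exact: sh_ev_assoc.
Defined.

Definition drb_law_alg : functor (DRB lam w) (alg_cat (lift_monad beta_law)).
Proof.
unshelve refine (@Functor (DRB lam w) (alg_cat (lift_monad beta_law)) drb_law_alg_ob _ _ _).
- move=> X Y f.
  refine (@AlgebraHom _ (lift_monad beta_law) (drb_law_alg_ob X) (drb_law_alg_ob Y)
    (fmap (DIF_coalg lam \F DRB_DIF lam w) f) _).
  by apply: coalg_hom_ext; symmetry; apply: sh_ev_natural; exact: op2_morP2 f.
- by move=> X; apply: algebra_hom_ext; exact: fmap_id.
- by move=> X Y Z g f; apply: algebra_hom_ext; exact: (fmap_comp (DIF_coalg lam \F DRB_DIF lam w)).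
Defined.

Section DrbOfLawAlgebra.
Variable Y : alg_cat (lift_monad beta_law).
Let R : calgType k := coalg_car (alg_car Y).
Let m : alg_hom R (hurwitz lam R) := coalg_map (alg_car Y).
Let a : alg_hom (Sh lam R) R := coalg_mor (alg_map Y).

Let mcounit u : m u 0%N = u.
Proof. exact: (alg_hom_fun (coalg_counit (alg_car Y)) u). Qed.

Let mcoassoc u n : iter n (hur_der lam _) (m u) = m (m u n).
Proof.
have E := alg_hom_fun (coalg_coassoc (alg_car Y)) u.
exact: (f_equal (fun x : hurwitz lam (hurwitz lam R) => x n) E).
Qed.

Let mdiff : is_diff lam (coalg_der m) := coalg_der_diff mcounit.

Let aunit u : a (sh_incl lam _ u) = u.
Proof. exact: (alg_hom_fun (lift_alg_unit Y) u). Qed.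

Let aassoc u : a (sh_ev (@sh_P_rb k lam _) u) = a (sh_map lam a u).
Proof. exact: (alg_hom_fun (lift_alg_assoc Y) u). Qed.

Let aext u : a (canon_ext lam w (coalg_der m) u) = coalg_der m (a u).
Proof.
have E := alg_hom_fun (coalg_morP (alg_map Y)) u.
have {}E := f_equal (fun x : hurwitz lam R => x 1%N) E.
apply: etrans E; apply: esym.
(* The structure map of the lifted coalgebra on Sh(R) has the canonical extension as its entry at
   index one. *)
have B := alg_hom_fun (beta_theta mdiff) u.
rewrite (coalg_theta mcounit mcoassoc) in B.
exact: (f_equal (fun x : hurwitz lam (Sh lam R) => a (x 1%N)) B).
Qed.

Definition drb_of_law_alg_ob : DRB lam w :=
  @Op2Alg k (drb_prop lam w) R (coalg_der m) (alg_rb a)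
    (And3 mdiff (alg_rb_rb aunit aassoc) (alg_rb_type aunit aassoc mdiff aext)).

Lemma drb_of_law_algK : drb_law_alg drb_of_law_alg_ob = Y.
Proof.
apply: (algebra_eq (@coalg_forget_faithful _ _)).
  apply: (@coalgebra_eq _ _ (id_functor (ALG k))) => //.
  by congr (Arrow (_ : @mor (ALG k) _ _)); exact: coalg_theta.
by congr (Arrow (_ : @mor (ALG k) _ _)); exact: alg_ev.
Qed.

End DrbOfLawAlgebra.

Lemma drb_law_algK (X : DRB lam w) : drb_of_law_alg_ob (drb_law_alg X) = X.
Proof.
by apply: op2_alg_eq; [exact: coalg_der_theta | exact: alg_rb_ev].
Qed.

Lemma law_alg_mor_der (X Y : alg_cat (lift_monad beta_law)) (f : mor X Y) u :
  coalg_mor (alg_mor f) (coalg_der (coalg_map (alg_car X)) u) =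
  coalg_der (coalg_map (alg_car Y)) (coalg_mor (alg_mor f) u).
Proof.
have E := alg_hom_fun (coalg_morP (alg_mor f)) u.
exact: (f_equal (fun x : hurwitz lam _ => x 1%N) E).
Qed.

Lemma law_alg_mor_rb (X Y : alg_cat (lift_monad beta_law)) (f : mor X Y) u :
  coalg_mor (alg_mor f) (alg_rb (coalg_mor (alg_map X)) u) =
  alg_rb (coalg_mor (alg_map Y)) (coalg_mor (alg_mor f) u).
Proof.
have E := alg_hom_fun (lift_alg_mor f) (sh_P lam _ (sh_incl lam _ u)).
apply: etrans E _; rewrite -[LHS]/(coalg_mor (alg_map Y) (sh_map lam _ _)).
by rewrite sh_map_P sh_map_incl.
Qed.

Definition drb_of_law_alg_mor (X Y : alg_cat (lift_monad beta_law)) (f : mor X Y) :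
  mor (drb_of_law_alg_ob X) (drb_of_law_alg_ob Y) :=
  @Op2Hom k _ _ _ _ _ _ (coalg_mor (alg_mor f)) (law_alg_mor_der f) (law_alg_mor_rb f).

Definition drb_of_law_alg : functor (alg_cat (lift_monad beta_law)) (DRB lam w).
Proof.
refine (@Functor (alg_cat (lift_monad beta_law)) (DRB lam w) drb_of_law_alg_ob
  drb_of_law_alg_mor _ _).
- by move=> X; apply: (@op2_forget_faithful k (drb_prop lam w)).
- by move=> X Y Z g f; apply: (@op2_forget_faithful k (drb_prop lam w)) => /=.
Defined.

Lemma drb_law_alg_iso : is_cat_iso drb_law_alg.
Proof.
apply: (@cat_iso_over (ALG k) _ _ (op2_forget _)
  (coalg_forget (hur_comonad lam) \F alg_forget (lift_monad beta_law)) _ drb_of_law_alg) => //.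
- exact: op2_forget_faithful.
- exact: comp_faithful (@alg_forget_faithful _ _) (@coalg_forget_faithful _ _).
- exact: drb_law_algK.
- exact: drb_of_law_algK.
Qed.

End MixedLaw.

Lemma ext_mixed_law :
  ext_diff <-> exists (b : mixed_law (sh_monad lam) (hur_comonad lam))
      (N : functor (DRB lam w) (alg_cat (lift_monad b))),
    [/\ is_cat_iso N,
        functor_eq (alg_forget (lift_monad b) \F N)
          (DIF_coalg lam \F DRB_DIF lam w)
      & forall X : DRB lam w,
          Arrow (fmap (coalg_forget (hur_comonad lam)) (alg_map (N X))) =
          Arrow (sh_ev (drb_rba (o2_opP X)) : @mor (ALG k) _ _)].
Proof.
split=> [extD|[b [N [isoN [ND _] Nev]]] R d dD].
  by exists (beta_law extD), (drb_law_alg extD); split; [exact: drb_law_alg_iso | split |].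
pose X : DIF lam := OpAlg dD; pose c := DIF_coalg lam X.
have [Z NZ] := cat_iso_surj (free_alg (lift_monad b) c) isoN.
have EZ : lift_monad b c = DIF_coalg lam (DRB_DIF lam w Z).
  by rewrite -[RHS]/((DIF_coalg lam \F DRB_DIF lam w) Z) -ND [RHS]/(alg_car (N Z)) NZ.
have [v Ev] := mor_transport (coalg_forget (hur_comonad lam)) (munit (lift_monad b) c) erefl EZ.
(* The transported unit is a coalgebra morphism; its square at index one makes it a morphism of
   differential algebras. *)
have vd x : coalg_mor v (d x) = o2_op1 Z (coalg_mor v x).
  have E := alg_hom_fun (coalg_morP v) x.
  exact: (f_equal (fun y : hurwitz lam _ => y 1%N) E).
apply: (@ext_diff_of_free X Z (@OpHom k _ _ d (o2_op1 Z) (coalg_mor v) vd)).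
  by rewrite -Nev NZ.
exact: Ev.
Qed.

End Implications.

Theorem theorem3p17 (k : comPzRingType) (lam : k) (w : omega k) :
  [<-> (* (a) *)
       forall (R : calgType k) (P : {linear R -> R}),
         is_rb lam P -> is_rb lam (canon_coext lam w P);
       (* (b) *)
       forall (R : calgType k) (d : {linear R -> R}),
         is_diff lam d -> is_diff lam (canon_ext lam w d);
       (* (c) *)
       exists G : functor (RBA lam) (DRB lam w),
         functor_eq (DRB_ODA lam w \F G) (G_fun lam w \F RBA_OA lam);
       (* (d) *)
       exists F : functor (DIF lam) (DRB lam w),
         functor_eq (DRB_ORB lam w \F F) (F_fun lam w \F DIF_OA0 lam);
       (* (e) *)
       exists W : comonad (RBA lam),
         lifts_comonad (RBA_ALG lam) (hur_comonad lam) W /\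
         exists H : functor (DRB lam w) (coalg_cat W),
           [/\ is_cat_iso H,
               functor_eq (coalg_forget W \F H) (DRB_RBA lam w)
             & forall X : DRB lam w,
                 Arrow (fmap (RBA_ALG lam) (coalg_map (H X))) =
                 Arrow (theta (drb_dif (o2_opP X)) : @mor (ALG k) _ _)];
       (* (f) *)
       exists T : monad (DIF lam),
         lifts_monad (DIF_ALG lam) (sh_monad lam) T /\
         exists K : functor (DRB lam w) (alg_cat T),
           [/\ is_cat_iso K,
               functor_eq (alg_forget T \F K) (DRB_DIF lam w)
             & forall X : DRB lam w,
                 Arrow (fmap (DIF_ALG lam) (alg_map (K X))) =
                 Arrow (sh_ev (drb_rba (o2_opP X)) : @mor (ALG k) _ _)];
       (* (g) *)
       exists (b : mixed_law (sh_monad lam) (hur_comonad lam))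
              (N : functor (DRB lam w) (alg_cat (lift_monad b))),
         [/\ is_cat_iso N,
             functor_eq (alg_forget (lift_monad b) \F N)
               (DIF_coalg lam \F DRB_DIF lam w)
           & forall X : DRB lam w,
               Arrow (fmap (coalg_forget (hur_comonad lam)) (alg_map (N X))) =
               Arrow (sh_ev (drb_rba (o2_opP X)) : @mor (ALG k) _ _)]].
Proof.
(* Each other statement is equivalent to (a) or to (b), and these two implications pass between them
   along the cycle. *)
have ab := @ext_diff_of_coext_rb k lam w.
have ba := @coext_rb_of_ext_diff k lam w.
tfae.
- exact: ab.
- by move=> /ba /coext_functor.
- by move=> /coext_functor /ab /ext_functor.
- by move=> /ext_functor /ba /coext_comonad.
- by move=> /coext_comonad /ab /ext_monad.
- by move=> /ext_monad /ext_mixed_law.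
- by move=> /ext_mixed_law /ba.
Qed.
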